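(* Let $\mu$ be a computable probability measure on $2^{\mathbb{N}}$, let $T\colon(2^{\mathbb{N}},\mu)\rightarrow2^{\mathbb{N}}$ be a Schnorr layerwise computable map, and let $y\in2^{\mathbb{N}}$ be $\mu_{T}$-computably random. Then $y=T(x)$ for some $\mu$-computably random $x\in2^{\mathbb{N}}$.
   Context: $2^{\mathbb{N}}$ is Cantor space, $[\sigma]$ the cylinder of sequences extending a finite string $\sigma\in2^*$, $\mu(\sigma)=\mu([\sigma])$. A finite Borel measure $\mu$ on $2^{\mathbb{N}}$ is computable if $\sigma\mapsto\mu(\sigma)$ is computable. A function $t\colon2^{\mathbb{N}}\to[0,\infty]$ is lower semicomputable if it is the sum of a computable sequence of computable functions $2^{\mathbb{N}}\to[0,\infty)$. For a finite Borel measure $\mu$, $x$ is $\mu$-computably random if $t(x)<\infty$ for every lower semicomputable $t$ and every computable probability measure $\nu$ with $\int_{[\sigma]}t\,d\mu\le\nu(\sigma)$ for all $\sigma\in2^{*}$. A (partial) measurable map $F$ from $2^{\mathbb{N}}$ to $2^{\mathbb{N}}$ is Schnorr layerwise computable with respect to a computable probability measure $\mu$ if there is a computable sequence of effectively closed ($\Pi^0_1$) sets $C_n\subseteq2^{\mathbb{N}}$ and a computable sequence of computable functions $F_n\colon C_n\to2^{\mathbb{N}}$ such that $\mu(C_n)\ge1-2^{-n}$, $\mu(C_n)$ is computable uniformly in $n$, and $F_n=F\upharpoonright C_n$ for all $n$. The pushforward is $\mu_T(B)=\mu(T^{-1}(B))$. *)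

(* Defs.v *)
From HB Require Import structures.
From mathcomp Require Import all_boot all_order all_algebra.
From mathcomp Require Import all_classical all_reals all_analysis.
Set Implicit Arguments.
Unset Strict Implicit.
Unset Printing Implicit Defensive.
Import Order.TTheory GRing.Theory Num.Theory.
Import numFieldNormedType.Exports.
Local Open Scope classical_set_scope.
Local Open Scope ring_scope.

(* Cantor space with its Borel sigma-algebra. *)
Notation cantor := (g_sigma_algebraType (@open cantor_space)).

Definition cylinder (s : seq bool) : set cantor :=
  [set x | mkseq x (size s) = s].

(* Partial recursive functions with an oracle, presented by the usual
   schemes.  Argument lists have no fixed length; missing arguments read
   as 0. *)
Inductive recf : Type :=
| RZero
| RSucc
| RProj of nat
| ROracle
| RComp of recf & seq recf
| RPrim of recf & recf
| RMin of recf.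

(* [eval o e args v]: on [args], the program [e] with oracle [o] halts with
   value [v].  In [RPrim f g] the recursion variable is the first argument,
   and the step [g] receives the index, the previous value and the
   parameters; [h i] is the value at [i]. *)
Fixpoint eval (o : nat -> bool) (e : recf) (args : seq nat) (v : nat) : Prop :=
  match e with
  | RZero => v = 0%N
  | RSucc => v = (nth 0%N args 0).+1
  | RProj i => v = nth 0%N args i
  | ROracle => v = o (nth 0%N args 0) :> nat
  | RComp f gs => exists2 ws : seq nat,
      (fix evals (gs : seq recf) (ws : seq nat) : Prop :=
         match gs, ws with
         | [::], [::] => True
         | g :: gs', w :: ws' => eval o g args w /\ evals gs' ws'
         | _, _ => False
         end) gs ws
      & eval o f ws v
  | RPrim f g => exists h : nat -> nat,
      [/\ eval o f (behead args) (h 0%N),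
          forall i, (i < nth 0 args 0)%N ->
            eval o g [:: i, h i & behead args] (h i.+1)
        & v = h (nth 0%N args 0)]
  | RMin f =>
      eval o f (v :: args) 0%N /\
      forall i, (i < v)%N -> exists w, eval o f (i :: args) w.+1
  end.

(* Computations on discrete data use the empty oracle. *)
Definition no_oracle : nat -> bool := fun=> false.

(* Finite strings as positive integers: the binary expansion whose bits,
   from the least significant one, are those of the string, then a 1. *)
Fixpoint code (s : seq bool) : nat :=
  if s is b :: s' then (b + (code s').*2)%N else 1%N.

Section Computability.
Context {R : realType}.

(* The program [e] computes [r] by dyadic approximations: numerators are
   naturals, so this describes nonnegative reals only, which is all that
   is needed below.  The precision is passed as the last argument. *)
Definition computes_real (o : nat -> bool) (e : recf) (args : seq nat)
    (r : R) : Prop :=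
  forall n : nat, exists2 m : nat, eval o e (rcons args n) m
    & `|r - m%:R / 2 ^+ n| <= 2 ^- n.

Definition computable_real_seq (r : nat -> R) : Prop :=
  exists e, forall n, computes_real no_oracle e [:: n] (r n).

Definition computable_measure (mu : {finite_measure set cantor -> \bar R}) :
    Prop :=
  exists e, forall s,
    computes_real no_oracle e [:: code s] (fine (mu (cylinder s))).

(* Computable sequence of computable functions into [0, +oo[. *)
Definition computable_fun_seq (g : nat -> cantor -> R) : Prop :=
  (forall k x, 0 <= g k x) /\
  exists e, forall k x, computes_real x e [:: k] (g k x).

Definition lower_semicomputable (t : cantor -> \bar R) : Prop :=
  exists2 g : nat -> cantor -> R, computable_fun_seq g
    & forall x, t x = (\sum_(0 <= k <oo) (g k x)%:E)%E.

Definition computably_random (mu : {finite_measure set cantor -> \bar R})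
    (x : cantor) : Prop :=
  forall (t : cantor -> \bar R) (nu : probability cantor R),
    lower_semicomputable t -> computable_measure nu ->
    (forall s, (\int[mu]_(z in cylinder s) t z <= nu (cylinder s))%E) ->
    (t x < +oo)%E.

End Computability.

(* The complement of [C n] is the union of the cylinders of a c.e. set of
   strings (the domain of a partial recursive function), uniformly in n. *)
Definition effectively_closed_seq (C : nat -> set cantor) : Prop :=
  exists e, forall n x, ~ C n x <->
    exists s, cylinder s x /\ exists v, eval no_oracle e [:: n; code s] v.

(* Computable sequence of computable functions [F n : C n -> 2^N]; nothing
   is required of the program, or of [F n], outside [C n]. *)
Definition computable_map_seq (C : nat -> set cantor)
    (F : nat -> cantor -> cantor) : Prop :=
  exists e, forall n x, C n x -> forall k, eval x e [:: n; k] (F n x k).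

(* Partial Borel maps; the values of [pfun] outside [pdom] are irrelevant. *)
Record partial_map := PartialMap {
  pdom : set cantor;
  pfun :> cantor -> cantor;
  measurable_pdom : measurable pdom;
  measurable_pfun : measurable_fun pdom pfun }.

Definition ppreimage (T : partial_map) (B : set cantor) : set cantor :=
  pdom T `&` T @^-1` B.

Definition schnorr_layerwise_computable {R : realType}
    (mu : probability cantor R) (T : partial_map) : Prop :=
  exists (C : nat -> set cantor) (F : nat -> cantor -> cantor),
    [/\ effectively_closed_seq C,
        computable_map_seq C F,
        forall n, ((1 - 2 ^- n)%:E <= mu (C n))%E,
        computable_real_seq (fun n => fine (mu (C n)))
      & forall n x, C n x -> pdom T x /\ F n x = T x].

Section PartialPushforward.
Context {R : realType}.
Local Open Scope ereal_scope.
Variables (mu : {finite_measure set cantor -> \bar R}) (T : partial_map).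

Definition ppushforward (B : set cantor) : \bar R := mu (ppreimage T B).

Let measurable_ppreimage B : measurable B -> measurable (ppreimage T B).
Proof. by move=> mB; apply: measurable_pfun => //; exact: measurable_pdom. Qed.

Let ppushforward0 : ppushforward set0 = 0.
Proof. by rewrite /ppushforward /ppreimage preimage_set0 setI0 measure0. Qed.

Let ppushforward_ge0 B : 0 <= ppushforward B.
Proof. exact: measure_ge0. Qed.

Let ppushforward_sigma_additive : semi_sigma_additive ppushforward.
Proof.
move=> F mF tF mUF; rewrite /ppushforward /ppreimage preimage_bigcup setI_bigcupr.
apply: measure_semi_sigma_additive.
- by move=> n; exact: measurable_ppreimage.
- move/trivIsetP : tF => tF; apply/trivIsetP => /= i j _ _ ij.
  have Fij : F i `&` F j = set0 by exact: tF.
  by rewrite setIACA -[X in _ `&` X]preimage_setI Fij preimage_set0 setI0.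
- rewrite -setI_bigcupr -preimage_bigcup; exact: measurable_ppreimage.
Qed.

HB.instance Definition _ := isMeasure.Build _ _ _
  ppushforward ppushforward0 ppushforward_ge0 ppushforward_sigma_additive.

Let ppushforward_fin : fin_num_fun ppushforward.
Proof.
by move=> B mB; apply: fin_num_measure; exact: measurable_ppreimage.
Qed.

HB.instance Definition _ := Measure_isFinite.Build _ _ _
  ppushforward ppushforward_fin.

End PartialPushforward.

(* Main.v *)
From Pilot Require Import Defs.
From HB Require Import structures.
From mathcomp Require Import all_boot all_order all_algebra.
From mathcomp Require Import all_classical all_reals all_analysis.
From mathcomp Require Import measurable_realfun zify ring lra.
(* MathComp-Analysis has another [eval]. *)
Import Pilot.Defs.
Set Implicit Arguments.
Unset Strict Implicit.
Unset Printing Implicit Defensive.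
Import Order.TTheory GRing.Theory Num.Theory.
Import numFieldNormedType.Exports.

(* Let [P] be the pushforward of [mu]. Searching simultaneously for a bit of
   [F m x] and for a proof that [x] is not in [C m] extends [F m] to a total
   computable map [Phi m], so that pushing a computable measure forward along
   [Phi m] gives a computable measure. Since [mu (C m)] is computable, so is
   the measure [mu (T^-1 B \ C m)], and since [y] is random (a computable
   martingale does not succeed on [y]), some [m] has
   [mu (T^-1 [y|n] & C m) > P [y|n] / 2] for all large [n]. For the same
   reason, each measure [kappa i] bounding a test for [mu] satisfies
   [a i * kappa i (Phi m^-1 [y|n]) <= P [y|n]] for some [a i > 0].

   Hence for suitable weights [v i > 0] and all large [n]
   [sum_(i < n) v i * kappa i (Phi m^-1 [y|n] & [s])
      < mu (C m & Phi m^-1 [y|n] & [s])]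
   holds for the empty string [s]. Both sides are additive in [s], so it holds
   along a path [x], for infinitely many [n] at each prefix of [x]. Positivity
   of the right hand side puts [x] in [C m] and gives [Phi m x = y]; and if
   the [i]-th test exceeded [1 / v i] at [x], it would do so on some [[s]], so
   that [v i * kappa i >= mu] on [[s]], contradicting the inequality. *)

(** * Closure properties of recursive functions *)

(** The layers [C m] are large for [mu] only. A measure [kappa i] may charge their complements
    heavily, so its image under the partial map [T] could lose mass and fail to be computable; total
    extensions [Phi m] avoid this.

    An effectively closed [C m] alone would make [mu (T^-1 B \ C m)] approximable from below only.
    Computability of [mu (C m)] turns it into a computable function of [B], that is, into a strategy
    that can be played against [y].

    Randomness bounds tests by computable probability measures, not by martingales. Hence countably
    many strategies are merged into one additive function on strings of total mass exactly [1],
    which is extended to a Borel probability before the randomness of [y] is applied.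

    Effectivity is spent on these strategies. The sequence [kappa], the constants [a i] and the path
    [x] are obtained by choice and by a pigeonhole argument. Stopping the weighted sum at [n] keeps
    it a finite sum of finite measures, and each fixed [i] still takes part for all large [n]. *)

Lemma uniform_bound (n : nat) (P : nat -> nat -> Prop) :
  (forall i k k', k <= k' -> P i k -> P i k') ->
  (forall i, i < n -> exists k, P i k) ->
  exists K, forall i, i < n -> P i K.
Proof.
move=> Pm; elim: n => [|n IHn] Pn; first by exists 0.
have [K PK] := IHn (fun i lt_in => Pn i (ltnW lt_in)).
have [k Pk] := Pn n (ltnSn n).
exists (maxn K k) => i; rewrite ltnS leq_eqVlt => /predU1P[->|/PK].
  by apply: Pm Pk; rewrite leq_maxr.
by apply: Pm; rewrite leq_maxl.
Qed.

Fixpoint recf_nested_ind (P : recf -> Prop) (PZero : P RZero) (PSucc : P RSucc)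
    (PProj : forall i, P (RProj i)) (POracle : P ROracle)
    (PComp : forall f gs, P f ->
       (forall i, i < size gs -> P (nth RZero gs i)) -> P (RComp f gs))
    (PPrim : forall f g, P f -> P g -> P (RPrim f g))
    (PMin : forall f, P f -> P (RMin f)) (e : recf) : P e :=
  let ind := recf_nested_ind PZero PSucc PProj POracle PComp PPrim PMin in
  match e with
  | RZero => PZero
  | RSucc => PSucc
  | RProj i => PProj i
  | ROracle => POracle
  | RComp f gs => PComp f gs (ind f)
      ((fix inds (gs : seq recf) : forall i, i < size gs -> P (nth RZero gs i) :=
         match gs with
         | [::] => fun i (lt_i : i < 0) => False_ind _ (notF lt_i)
         | g :: gs' => fun i => match i with
                                | 0 => fun=> ind g
                                | i'.+1 => inds gs' i'
                                end
         end) gs)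
  | RPrim f g => PPrim f g (ind f) (ind g)
  | RMin f => PMin f (ind f)
  end.

(** The anonymous fixpoint in [eval] is traded for a condition on positions, in the form in which
    [recf_nested_ind] supplies its hypotheses. *)
Lemma eval_comp o f gs s v :
  eval o (RComp f gs) s v <->
  exists2 ws, size ws = size gs /\
      (forall i, i < size gs -> eval o (nth RZero gs i) s (nth 0 ws i))
    & eval o f ws v.
Proof.
have evalsE : forall ws, (fix evals (gs : seq recf) (ws : seq nat) : Prop :=
    match gs, ws with
    | [::], [::] => True
    | g :: gs', w :: ws' => eval o g s w /\ evals gs' ws'
    | _, _ => False
    end) gs ws <-> size ws = size gs /\
      (forall i, i < size gs -> eval o (nth RZero gs i) s (nth 0 ws i)).
  elim: gs => [|g gs IHgs] [|w ws] /=; [by split|by split=> -[]|by split=> -[]|].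
  split=> [[gw /IHgs[-> gsw]]|[[sz] gsw]]; first by split=> [//|[|i]] //; exact: gsw.
  split; [exact: (gsw 0)|apply/IHgs; split=> [|i]; [done|exact: (gsw i.+1)]].
by split=> -[ws /evalsE ? ?]; exists ws => //; apply/evalsE.
Qed.

(** A program mentions finitely many positions, whatever the oracle, and absent arguments read as
    [0]. The bound comes from the syntax; primitive recursion raises it by one, for the recursion
    variable. *)
Lemma eval_arity e : exists k, forall o s s' v,
  (forall i, i < k -> nth 0 s i = nth 0 s' i) -> eval o e s v -> eval o e s' v.
Proof.
elim/recf_nested_ind: e => [||i||f gs [kf IHf] IHgs|f g [kf IHf] [kg IHg]|f [k IHf]].
- by exists 0.
- by exists 1 => o s s' v /= /(_ 0 isT) ->.
- by exists i.+1 => o s s' v /= /(_ i (ltnSn i)) ->.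
- by exists 1 => o s s' v /= /(_ 0 isT) ->.
- have [|K IHK] := uniform_bound _ IHgs.
    by move=> i k k' le_kk' IH o s s' v ss'; apply: IH => j /leq_trans/(_ le_kk')/ss'.
  exists K => o s s' v ss' /eval_comp[ws [sz gsw] fw]; apply/eval_comp.
  by exists ws => //; split=> // i lt_i; apply: IHK (gsw i lt_i).
- exists (maxn kf kg).+1 => o s s' v ss' /= [h [h0 hS ->]].
  exists h; rewrite -ss'//; split=> //.
    by apply: IHf h0 => i lt_i; rewrite !nth_behead ss'// ltnS leq_max lt_i.
  move=> i /hS; apply: IHg => -[|[|j]] //= lt_j.
  by rewrite !nth_behead ss'// ltnS leq_max (ltn_trans _ lt_j) ?orbT.
- exists k => o s s' v ss' /= [f0 fS]; split.
    by apply: IHf f0 => -[|i] //= lt_i; rewrite ss'// ltnW.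
  move=> i /fS[w fw]; exists w.
  by apply: IHf fw => -[|j] //= lt_j; rewrite ss'// ltnW.
Qed.

(** [no_oracle] always answers [0], so erasing the oracle calls turns a program for the empty oracle
    into one that behaves alike under every oracle. This is how programs on discrete data enter
    [recursive], which asks for all oracles at once. *)
Fixpoint strip (e : recf) : recf :=
  match e with
  | ROracle => RZero
  | RComp f gs => RComp (strip f) (map strip gs)
  | RPrim f g => RPrim (strip f) (strip g)
  | RMin f => RMin (strip f)
  | _ => e
  end.

Lemma eval_strip o e s v : eval o (strip e) s v <-> eval no_oracle e s v.
Proof.
elim/recf_nested_ind: e s v => [||i||f gs IHf IHgs|f g IHf IHg|f IHf] s v //.
- rewrite (_ : strip _ = RComp (strip f) (map strip gs))//.
  split=> /eval_comp[ws [sz gsw] fw]; apply/eval_comp; exists ws; try exact/IHf.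
    rewrite size_map in sz gsw; split=> // i lt_i.
    by have := gsw i lt_i; rewrite (nth_map RZero)// => /IHgs; apply.
  rewrite size_map; split=> // i lt_i.
  by rewrite (nth_map RZero)//; apply/IHgs/gsw.
- split=> /= -[h [h0 hS ->]]; exists h; split=> //; try exact/IHf;
    by move=> i /hS/IHg.
- split=> /= -[/IHf f0 fS]; split=> // i /fS[w /IHf fw]; by exists w.
Qed.

Definition recursive (f : (nat -> bool) -> seq nat -> nat) : Prop :=
  exists e, forall o s, eval o e s (f o s).

Definition recursive_list (l : (nat -> bool) -> seq nat -> seq nat) : Prop :=
  forall i, recursive (fun o s => nth 0 (l o s) i).

Lemma rec_ext f g : (forall o s, f o s = g o s) -> recursive g -> recursive f.
Proof. by move=> fg [e eg]; exists e => o s; rewrite fg. Qed.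

(* [RComp] only builds lists of a fixed length; by [eval_arity] a long enough
   prefix of [l o s] suffices. *)
Lemma rec_subst f l :
  recursive f -> recursive_list l -> recursive (fun o s => f o (l o s)).
Proof.
move=> [e ef] /choice[gs gsl]; have [k ek] := eval_arity e.
exists (RComp e (mkseq gs k)) => o s; apply/eval_comp.
exists (mkseq (nth 0 (l o s)) k); last first.
  by apply: ek (ef _ _) => i lt_i; rewrite nth_mkseq.
rewrite !size_mkseq; split=> // i lt_i; rewrite !nth_mkseq//; exact: gsl.
Qed.

Lemma rec_list_id : recursive_list (fun _ s => s).
Proof. by move=> i; exists (RProj i). Qed.

Lemma rec_list_cons f l :
  recursive f -> recursive_list l -> recursive_list (fun o s => f o s :: l o s).
Proof. by move=> ff ll [|i]; [exact: ff | exact: ll]. Qed.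

Lemma rec_list_behead l :
  recursive_list l -> recursive_list (fun o s => behead (l o s)).
Proof. by move=> ll i; apply: rec_ext (ll i.+1) => o s; rewrite nth_behead. Qed.

Lemma rec_list_nil : recursive_list (fun _ _ => [::]).
Proof. by move=> i; exists RZero => o s /=; rewrite nth_nil. Qed.

Lemma rec_nth l i : recursive_list l -> recursive (fun o s => nth 0 (l o s) i).
Proof. exact. Qed.

Lemma rec_oracle f : recursive f -> recursive (fun o s => o (f o s)).
Proof.
move=> ff; have [e ee] : recursive (fun o s => o (nth 0 s 0)) by exists ROracle.
apply: (@rec_subst (fun o s => o (nth 0 s 0)) (fun o s => [:: f o s])).
  by exists e.
exact: rec_list_cons rec_list_nil.
Qed.

Lemma rec_succ f : recursive f -> recursive (fun o s => (f o s).+1).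
Proof.
move=> ff; apply: (@rec_subst (fun o s => (nth 0 s 0).+1) (fun o s => [:: f o s])).
  by exists RSucc.
exact: rec_list_cons rec_list_nil.
Qed.

Lemma rec_const n : recursive (fun _ _ => n).
Proof. by elim: n => [|n]; [exists RZero | apply: rec_succ]. Qed.

(** Bound variables are encoded by list positions: the step finds the index and the previous value
    at the head of the list and the parameters behind them. The other binders (minimization, sums,
    bounded search) use one head position in the same way. *)
Lemma rec_iteri n f g : recursive n -> recursive f ->
  recursive (fun o s => g o (behead (behead s)) (nth 0 s 0) (nth 0 s 1)) ->
  recursive (fun o s => iteri (n o s) (g o s) (f o s)).
Proof.
move=> nn [e ef] [e' eg].
pose it o s := iteri (nth 0 s 0) (g o (behead s)) (f o (behead s)).
apply: (@rec_subst it (fun o s => n o s :: s)); last first.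
  exact/rec_list_cons/rec_list_id.
exists (RPrim e e') => o s /=.
exists (fun i => iteri i (g o (behead s)) (f o (behead s))).
by split=> // i _; exact: (eg o (_ :: _ :: behead s)).
Qed.

Lemma rec_min f m : recursive (fun o s => f o (behead s) (nth 0 s 0)) ->
  (forall o s, f o s (m o s) = 0 /\ forall i, i < m o s -> 0 < f o s i) ->
  recursive m.
Proof.
move=> [e ef] fm; exists (RMin e) => o s /=; have [f0 fS] := fm o s; split.
  by rewrite -f0; exact: (ef o (_ :: _)).
move=> i /fS lt0; exists (f o s i).-1; rewrite prednK//; exact: (ef o (_ :: _)).
Qed.

Lemma iteri_addn a b : iteri b (fun _ h => h.+1) a = a + b.
Proof. by elim: b => [|b /= ->]; rewrite ?addn0 ?addnS. Qed.

Lemma rec_add f g :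
  recursive f -> recursive g -> recursive (fun o s => f o s + g o s).
Proof.
move=> ff gg; apply: (rec_ext (fun o s => esym (iteri_addn _ _))).
apply: (@rec_iteri g f (fun _ _ _ h => h.+1)) => //.
exact/rec_succ/rec_nth/rec_list_id.
Qed.

Lemma rec_pred f : recursive f -> recursive (fun o s => (f o s).-1).
Proof.
move=> ff.
apply: (@rec_ext _ (fun o s => iteri (f o s) (fun i _ => i) 0)).
  by move=> o s; case: (f o s).
apply: (@rec_iteri f (fun _ _ => 0) (fun _ _ i _ => i)) => //.
  exact: rec_const.
exact/rec_nth/rec_list_id.
Qed.

Lemma rec_sub f g :
  recursive f -> recursive g -> recursive (fun o s => f o s - g o s).
Proof.
move=> ff gg.
apply: (@rec_ext _ (fun o s => iteri (g o s) (fun _ h => h.-1) (f o s))).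
  by move=> o s; elim: (g o s) => [|b /= <-]; rewrite ?subn0 ?subnS.
apply: (@rec_iteri g f (fun _ _ _ h => h.-1)) => //.
exact/rec_pred/rec_nth/rec_list_id.
Qed.

Lemma rec_sum n f : recursive n ->
  recursive (fun o s => f o (behead s) (nth 0 s 0)) ->
  recursive (fun o s => \sum_(0 <= i < n o s) f o s i).
Proof.
move=> nn ff.
apply: (@rec_ext _ (fun o s => iteri (n o s) (fun i h => h + f o s i) 0)).
  move=> o s; elim: (n o s) => [|k IHk]; first by rewrite big_geq.
  by rewrite big_nat_recr //= IHk.
apply: (@rec_iteri n (fun _ _ => 0) (fun o s i h => h + f o s i)) => //.
  exact: rec_const.
apply: rec_add; first exact/rec_nth/rec_list_id.
apply: (rec_subst ff (l := fun o s => nth 0 s 0 :: behead (behead s))).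
apply: rec_list_cons; first exact/rec_nth/rec_list_id.
exact/rec_list_behead/rec_list_behead/rec_list_id.
Qed.

Lemma rec_mul f g :
  recursive f -> recursive g -> recursive (fun o s => f o s * g o s).
Proof.
move=> ff gg; apply: (@rec_ext _ (fun o s => \sum_(0 <= i < g o s) f o s)).
  by move=> o s; rewrite sum_nat_const_nat subn0 mulnC.
apply: (@rec_sum g (fun o s _ => f o s)) => //.
exact: rec_subst ff (rec_list_behead rec_list_id).
Qed.

Lemma rec_eq0 f : recursive f -> recursive (fun o s => f o s == 0).
Proof.
move=> ff; apply: (@rec_ext _ (fun o s => 1 - f o s)).
  by move=> o s; case: (f o s).
by apply: rec_sub => //; exact: rec_const.
Qed.

Lemma rec_neg (p : _ -> _ -> bool) :
  recursive (fun o s => p o s) -> recursive (fun o s => ~~ p o s).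
Proof.
move=> /rec_eq0; apply: rec_ext => o s; by case: (p o s).
Qed.

Lemma rec_leq f g :
  recursive f -> recursive g -> recursive (fun o s => f o s <= g o s).
Proof. by move=> ff gg; exact/rec_eq0/rec_sub. Qed.

Lemma rec_and (p q : _ -> _ -> bool) :
  recursive (fun o s => p o s) -> recursive (fun o s => q o s) ->
  recursive (fun o s => p o s && q o s).
Proof.
move=> pp qq; apply: rec_ext (rec_mul pp qq) => o s; by rewrite mulnb.
Qed.

Lemma rec_or (p q : _ -> _ -> bool) :
  recursive (fun o s => p o s) -> recursive (fun o s => q o s) ->
  recursive (fun o s => p o s || q o s).
Proof.
move=> /rec_neg pp /rec_neg qq; apply: rec_ext (rec_neg (rec_and pp qq)) => o s.
by rewrite negb_and !negbK.
Qed.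

Lemma rec_eq f g :
  recursive f -> recursive g -> recursive (fun o s => f o s == g o s).
Proof.
move=> ff gg; apply: rec_ext (rec_and (rec_leq ff gg) (rec_leq gg ff)) => o s.
by rewrite eqn_leq.
Qed.

Lemma rec_eqb (p q : _ -> _ -> bool) :
  recursive (fun o s => p o s) -> recursive (fun o s => q o s) ->
  recursive (fun o s => p o s == q o s).
Proof.
move=> pp qq; apply: rec_ext (rec_eq pp qq) => o s.
by case: (p o s); case: (q o s).
Qed.

Lemma rec_if (p : _ -> _ -> bool) f g : recursive (fun o s => p o s) ->
  recursive f -> recursive g ->
  recursive (fun o s => if p o s then f o s else g o s).
Proof.
move=> pp ff gg.
apply: rec_ext (rec_add (rec_mul pp ff) (rec_mul (rec_neg pp) gg)) => o s.
by case: (p o s); rewrite /= !mul1n !mul0n ?addn0.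
Qed.

Lemma rec_exp f g :
  recursive f -> recursive g -> recursive (fun o s => f o s ^ g o s).
Proof.
move=> ff gg.
apply: (@rec_ext _ (fun o s => iteri (g o s) (fun _ h => h * f o s) 1)).
  by move=> o s; elim: (g o s) => //= k <-; rewrite expnSr.
apply: (@rec_iteri g (fun _ _ => 1) (fun o s _ h => h * f o s)) => //.
  exact: rec_const.
apply: rec_mul; first exact/rec_nth/rec_list_id.
exact: rec_subst ff (rec_list_behead (rec_list_behead rec_list_id)).
Qed.

Lemma rec_max f g :
  recursive f -> recursive g -> recursive (fun o s => maxn (f o s) (g o s)).
Proof.
move=> ff gg; apply: rec_ext (rec_if (rec_leq ff gg) gg ff) => o s.
by rewrite /maxn; case: ltngtP.
Qed.

Lemma rec_minn f g :
  recursive f -> recursive g -> recursive (fun o s => minn (f o s) (g o s)).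
Proof.
move=> ff gg; apply: rec_ext (rec_if (rec_leq ff gg) ff gg) => o s.
by rewrite /minn; case: ltngtP.
Qed.

Lemma rec_odd f : recursive f -> recursive (fun o s => odd (f o s)).
Proof.
move=> ff; apply: (@rec_ext _ (fun o s => iteri (f o s) (fun _ h => h == 0) 0)).
  by move=> o s; elim: (f o s) => //= n <-; case: (odd n).
apply: (@rec_iteri f (fun _ _ => 0) (fun _ _ _ h => h == 0)) => //.
  exact: rec_const.
exact/rec_eq0/rec_nth/rec_list_id.
Qed.

Lemma sum_ltn m n : n <= m -> \sum_(0 <= i < m) (i < n) = n.
Proof.
move=> le_nm; rewrite (big_cat_nat (leq0n _) le_nm)/=.
rewrite big_nat (eq_bigr (fun=> 1)) => [|i /andP[_ ->]]//.
rewrite -big_nat sum_nat_const_nat subn0 muln1.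
by rewrite big_nat big1 ?addn0// => i /andP[le_i _]; rewrite ltnNge le_i.
Qed.

Lemma divn_sum m d : 0 < d -> m %/ d = \sum_(0 <= i < m) (i.+1 * d <= m).
Proof.
move=> d_gt0; rewrite -[LHS](sum_ltn (leq_div m d)).
by apply: eq_bigr => i _; rewrite leq_divRL.
Qed.

Lemma rec_div_exp2 f g :
  recursive f -> recursive g -> recursive (fun o s => f o s %/ 2 ^ g o s).
Proof.
move=> ff gg; apply: (@rec_ext _ (fun o s =>
    \sum_(0 <= i < f o s) (i.+1 * 2 ^ g o s <= f o s))).
  by move=> o s; rewrite divn_sum// expn_gt0.
have lb := rec_list_behead rec_list_id.
apply: (@rec_sum f (fun o s i => i.+1 * 2 ^ g o s <= f o s)) => //.
apply: rec_leq; last exact: rec_subst ff lb.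
apply: rec_mul; first exact/rec_succ/rec_nth/rec_list_id.
by apply: rec_exp; [exact: rec_const | exact: rec_subst gg lb].
Qed.

(** The accumulator keeps pace with the index as long as [p] fails, and stays behind for good from
    the first success on. *)
Lemma find_iota_iteri p n :
  find p (iota 0 n) = iteri n (fun i h => h + ((h == i) && ~~ p i)) 0.
Proof.
elim: n => // n IHn; rewrite -[in LHS]addn1 iotaD find_cat/= add0n -IHn size_iota.
have := find_size p (iota 0 n); rewrite has_find size_iota.
by case: ltngtP => //; case: (p n) => /=; lia.
Qed.

Lemma rec_find n (p : _ -> _ -> _ -> bool) : recursive n ->
  recursive (fun o s => p o (behead s) (nth 0 s 0)) ->
  recursive (fun o s => find (p o s) (iota 0 (n o s))).
Proof.
move=> nn pp; apply: (rec_ext (fun o s => find_iota_iteri _ _)).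
apply: (@rec_iteri n (fun _ _ => 0)
  (fun o s i h => h + ((h == i) && ~~ p o s i))) => //; first exact: rec_const.
have id := rec_list_id; apply: rec_add; first exact: rec_nth.
apply: rec_and; first exact/rec_eq/rec_nth/id/rec_nth/id.
apply: rec_neg.
apply: (rec_subst pp (l := fun o s => nth 0 s 0 :: behead (behead s))).
by apply: rec_list_cons; [exact: rec_nth|exact/rec_list_behead/rec_list_behead].
Qed.

Lemma rec_has n (p : _ -> _ -> _ -> bool) : recursive n ->
  recursive (fun o s => p o (behead s) (nth 0 s 0)) ->
  recursive (fun o s => has (p o s) (iota 0 (n o s))).
Proof.
move=> nn pp; apply: rec_ext (rec_leq (rec_succ (rec_find nn pp)) nn) => o s.
by rewrite has_find size_iota.
Qed.

Lemma rec_all n (p : _ -> _ -> _ -> bool) : recursive n ->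
  recursive (fun o s => p o (behead s) (nth 0 s 0)) ->
  recursive (fun o s => all (p o s) (iota 0 (n o s))).
Proof.
move=> nn pp; have /= := rec_neg (rec_has nn (p := fun o s i => ~~ p o s i) (rec_neg pp)).
apply: rec_ext => o s; rewrite -all_predC; congr nat_of_bool.
by apply: eq_all => i /=; rewrite negbK.
Qed.

(** * Codes of strings *)

Lemma rec_trunc_log f : recursive f -> recursive (fun o s => trunc_log 2 (f o s)).
Proof.
move=> ff; apply: (@rec_ext _ (fun o s =>
    \sum_(0 <= i < f o s) (2 ^ i.+1 <= f o s))).
  move=> o s; have [->|f_gt0] := posnP (f o s); first by rewrite big_geq.
  rewrite -[LHS](@sum_ltn (f o s)); last first.
    have := trunc_logP (isT : 1 < 2) f_gt0; apply: leq_trans.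
    exact/ltnW/ltn_expl.
  apply: eq_bigr => i _; congr nat_of_bool; apply/idP/idP => [lt_i|].
    by apply: leq_trans (trunc_logP (isT : 1 < 2) f_gt0); rewrite leq_exp2l.
  exact: trunc_log_max.
have lb := rec_list_behead rec_list_id.
apply: (@rec_sum f (fun o s i => 2 ^ i.+1 <= f o s)) => //.
apply: rec_leq; last exact: rec_subst ff lb.
apply: rec_exp; [exact: rec_const | exact/rec_succ/rec_nth/rec_list_id].
Qed.

Ltac rec_core :=
  first
  [ assumption
  | lazymatch goal with
    | |- recursive (fun _ _ => nat_of_bool (~~ _)) => apply: rec_neg
    | |- recursive (fun _ _ => nat_of_bool (_ <= _)) => apply: rec_leq
    | |- recursive (fun _ _ => nat_of_bool (_ && _)) => apply: rec_and
    | |- recursive (fun _ _ => nat_of_bool (_ || _)) => apply: rec_or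
    | |- recursive (fun _ _ => nat_of_bool (@eq_op _ _ 0)) => apply: rec_eq0
    | |- recursive (fun _ _ => nat_of_bool (odd _)) => apply: rec_odd
    | |- recursive (fun _ _ => nat_of_bool (has _ (iota 0 _))) => apply: rec_has
    | |- recursive (fun _ _ => nat_of_bool (all _ (iota 0 _))) => apply: rec_all
    | |- recursive (fun _ _ => find _ (iota 0 _)) => apply: rec_find
    | |- recursive (fun _ _ => S _) => apply: rec_succ
    | |- recursive (fun _ _ => _.-1) => apply: rec_pred
    | |- recursive (fun _ _ => addn _ _) => apply: rec_add
    | |- recursive (fun _ _ => subn _ _) => apply: rec_sub
    | |- recursive (fun _ _ => muln _ _) => apply: rec_mul
    | |- recursive (fun _ _ => divn _ (expn 2 _)) => apply: rec_div_exp2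
    | |- recursive (fun _ _ => expn _ _) => apply: rec_exp
    | |- recursive (fun _ _ => maxn _ _) => apply: rec_max
    | |- recursive (fun _ _ => minn _ _) => apply: rec_minn
    | |- recursive (fun _ _ => trunc_log 2 _) => apply: rec_trunc_log
    | |- recursive (fun _ _ => bigop.body _ _ _) => apply: rec_sum
    | |- recursive (fun _ _ => iteri _ _ _) => apply: rec_iteri
    | |- recursive (fun _ _ => if _ then _ else _) => apply: rec_if
    | |- recursive (fun _ _ => nth 0 _ _) => apply: rec_nth
    | |- recursive_list (fun _ s => s) => exact: rec_list_id
    | |- recursive_list (fun _ _ => behead _) => apply: rec_list_behead
    | |- recursive_list (fun _ _ => cons _ _) => apply: rec_list_cons
    | |- recursive_list (fun _ _ => nil) => exact: rec_list_nil
    end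
  | exact: rec_const
  | lazymatch goal with
    | |- recursive (fun _ _ => nat_of_bool (@eq_op bool _ _)) => apply: rec_eqb
    | |- recursive (fun _ _ => nat_of_bool (@eq_op _ _ _)) => apply: rec_eq
    end
  | match goal with
    | H : recursive _ |- recursive _ => apply: (rec_subst H)
    end ].
Ltac rec_tac := repeat (rec_core; cbv beta).

(** The function is total: [0], which codes no string, is decoded as the empty string, just as [1]
    is. *)
Definition decode (c : nat) : seq bool :=
  mkseq (fun i => odd (c %/ 2 ^ i)) (trunc_log 2 c).

Lemma code_bounds s : 2 ^ size s <= code s < 2 ^ (size s).+1.
Proof.
elim: s => //= b s; rewrite !expnS; move: (2 ^ size s) (code s) => k c.
by case: b => /=; lia.
Qed.

Lemma trunc_log_code s : trunc_log 2 (code s) = size s.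
Proof. by apply: trunc_log_eq => //; exact: code_bounds. Qed.

Lemma odd_code s i : i < size s -> odd (code s %/ 2 ^ i) = nth false s i.
Proof.
elim: s i => //= b s IHs [_|i lt_i] /=.
  by rewrite divn1 oddD odd_double addbF; case: b.
by rewrite expnS divnMA -IHs// -muln2 addnC divnMDl// (@divn_small b) ?addn0//; case: b.
Qed.

Lemma codeK : cancel code decode.
Proof.
move=> s; rewrite /decode trunc_log_code.
apply: (@eq_from_nth _ false); rewrite size_mkseq// => i lt_i.
by rewrite nth_mkseq// odd_code.
Qed.

Lemma code_surj c : 0 < c -> exists s, c = code s.
Proof.
elim/ltn_ind: c => -[//|[|c]] IHc _; first by exists [::].
have [||s eq_s] := IHc (c.+2./2); [lia|lia|].
exists (odd c.+2 :: s); rewrite /= -eq_s.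
by have := odd_double_half c.+2; rewrite /= => ->.
Qed.

Lemma decodeK c : 0 < c -> code (decode c) = c.
Proof. by move=> /code_surj[s ->]; rewrite codeK. Qed.

(** The new bit takes the place of the final [1], which moves up one position. *)
Lemma code_rcons s b : code (rcons s b) = code s + b.+1 * 2 ^ size s.
Proof.
elim: s => [|a s IHs] /=; first by case: b.
by rewrite IHs expnS -!muln2; lia.
Qed.

Lemma code_mkseq f n : code (mkseq f n) = \sum_(0 <= i < n) f i * 2 ^ i + 2 ^ n.
Proof.
elim: n => [|n IHn]; first by rewrite big_geq.
by rewrite mkseqS code_rcons IHn big_nat_recr//= size_mkseq expnS; lia.
Qed.

Lemma rec_code_mkseq n (p : _ -> _ -> _ -> bool) : recursive n ->
  recursive (fun o s => p o (behead s) (nth 0 s 0)) ->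
  recursive (fun o s => code (mkseq (p o s) (n o s))).
Proof.
move=> nn pp; apply: (rec_ext (fun o s => code_mkseq _ _)). rec_tac.
Qed.

Lemma size_decode c : size (decode c) = trunc_log 2 c.
Proof. exact: size_mkseq. Qed.

Lemma nth_decode c i : nth false (decode c) i = (i < trunc_log 2 c) && odd (c %/ 2 ^ i).
Proof.
case: ltnP => [lt_i|le_i]; first by rewrite nth_mkseq.
by rewrite nth_default// size_mkseq.
Qed.

Lemma rec_nth_decode f g : recursive f -> recursive g ->
  recursive (fun o s => nth false (decode (f o s)) (g o s)).
Proof.
by move=> ff gg; apply: (rec_ext (fun o s => congr1 _ (nth_decode _ _))); rec_tac.
Qed.

Lemma rec_size_decode f : recursive f ->
  recursive (fun o s => size (decode (f o s))).
Proof.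
by move=> ff; apply: (rec_ext (fun o s => size_decode _)); rec_tac.
Qed.

Lemma rec_code_take f g : recursive f -> recursive g ->
  recursive (fun o s => code (take (f o s) (decode (g o s)))).
Proof.
move=> ff gg; apply: (@rec_ext _ (fun o s =>
    code (mkseq (nth false (decode (g o s)))
      (minn (f o s) (size (decode (g o s))))))).
  move=> o s; congr code; apply: (@eq_from_nth _ false).
    by rewrite size_mkseq size_take_min.
  move=> i; rewrite size_take_min => lt_i; rewrite nth_mkseq// nth_take//.
  by apply: leq_trans lt_i _; rewrite geq_minl.
apply: (@rec_code_mkseq _ (fun o s => nth false (decode (g o s)))).
  by apply: rec_minn => //; exact: rec_size_decode.
by apply: rec_nth_decode; rec_tac.
Qed.

(** * Bounded simulation of programs *)

(* Bounded simulation: [c] codes a prefix of the oracle and also bounds all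
   unbounded searches; the result is [0] for "no answer yet", [v.+1] for the
   answer [v]. In the search, the state [1] means that an argument is
   undecided, so that the search is stuck. *)
Fixpoint run (c : nat) (e : recf) (s : seq nat) : nat :=
  match e with
  | RZero => 1
  | RSucc => (nth 0 s 0).+2
  | RProj i => (nth 0 s i).+1
  | ROracle => if nth 0 s 0 < trunc_log 2 c
               then (odd (c %/ 2 ^ nth 0 s 0)).+1 else 0
  | RComp f gs =>
      let ws := [seq run c g s | g <- gs] in
      if 0 \in ws then 0 else run c f [seq w.-1 | w <- ws]
  | RPrim f g =>
      iteri (nth 0 s 0)
        (fun i h => if h == 0 then 0 else run c g [:: i, h.-1 & behead s])
        (run c f (behead s))
  | RMin f =>
      (iteri c
        (fun i h => if h == 0 then
           if run c f (i :: s) == 0 then 1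
           else if run c f (i :: s) == 1 then i.+2 else 0
         else h) 0).-1
  end.

Local Notation prefix_code x n := (code (mkseq x n)).

(** The code of a prefix is also the search bound of [run], so it has to exceed any given value once
    the prefix is long enough. *)
Lemma leq_prefix_code (x : nat -> bool) n : n < prefix_code x n.
Proof.
have /andP[+ _] := code_bounds (mkseq x n); rewrite size_mkseq.
by apply: leq_trans; exact: ltn_expl.
Qed.

Section MinSearch.
Variable F : nat -> nat.

(** Here [F i] is a coded answer: [0] is undecided, [1] is the answer zero, larger values are
    positive answers. The predecessor taken in [run] sends both the unfinished state [0] and the
    stuck state [1] to no answer. *)
Let search c := iteri c (fun i h => if h == 0 then
  if F i == 0 then 1 else if F i == 1 then i.+2 else 0 else h) 0.

Let searchP c : match search c with
  | 0 => forall i, i < c -> 1 < F i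
  | 1 => True
  | v.+2 => F v = 1 /\ forall i, i < v -> 1 < F i
  end.
Proof.
elim: c => //= c; rewrite -/(search c); case: (search c) => [IH|[|v]]//=.
case: (posnP (F c)) => // F_gt0.
have [F1|F_neq1] := eqVneq (F c) 1; first by split.
move=> i; rewrite ltnS leq_eqVlt => /predU1P[->|/IH//]; lia.
Qed.

Lemma min_search_sound c : 0 < (search c).-1 ->
  F (search c).-2 = 1 /\ forall i, i < (search c).-2 -> 1 < F i.
Proof. by have := searchP c; case: (search c) => [|[|v]]. Qed.

Lemma min_search_complete c v : v < c ->
  F v = 1 -> (forall i, i < v -> 1 < F i) -> search c = v.+2.
Proof.
move=> lt_vc Fv ltF; elim: c lt_vc => //= c IHc.
rewrite ltnS leq_eqVlt -/(search c) => /predU1P[<-|lt_vc]; last first.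
  by rewrite IHc.
suff -> : search v = 0 by rewrite Fv.
elim: {c IHc Fv} v ltF => //= v IHv ltF; rewrite -/(search v) IHv/=.
  by have := ltF v (ltnSn v); case: (F v) => [|[|]].
by move=> i lt_i; apply: ltF; exact: ltnW.
Qed.

End MinSearch.

Lemma run_sound x n e s :
  0 < run (prefix_code x n) e s -> eval x e s (run (prefix_code x n) e s).-1.
Proof.
set c := prefix_code x n.
elim/recf_nested_ind: e s => [||i||f gs IHf IHgs|f g IHf IHg|f IHf] s //.
- rewrite /= /c trunc_log_code size_mkseq; case: ifP => // lt_n _.
  by rewrite odd_code ?size_mkseq// nth_mkseq.
- rewrite [run _ _ _]/=; case: ifPn => // gs0 run_f; apply/eval_comp.
  exists [seq w.-1 | w <- [seq run c g s | g <- gs]]; last exact: IHf.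
  rewrite !size_map; split=> // i lt_i.
  rewrite (nth_map 0) ?size_map// (nth_map RZero)//; apply: IHgs => //.
  rewrite lt0n; apply: contra gs0 => /eqP gi0.
  have : nth 0 [seq run c g s | g <- gs] i \in [seq run c g s | g <- gs].
    by rewrite mem_nth ?size_map.
  by rewrite (nth_map RZero)// gi0.
- pose it k := iteri k
    (fun i h => if h == 0 then 0 else run c g [:: i, h.-1 & behead s])
    (run c f (behead s)).
  rewrite -[run _ _ _]/(it (nth 0 s 0)).
  (* Zero is absorbing, so a positive final value makes all earlier stages positive; their
     predecessors are the history required by [eval]. *)
  have it_gt0 k : 0 < it k.+1 -> 0 < it k.
    by rewrite /it /= -/(it k); case: (it k).
  move=> it_s; have {}it_s k : k <= nth 0 s 0 -> 0 < it k.
    move: (nth 0 s 0) it_s => m it_m; elim: m it_m => [|m IHm] it_m.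
      by rewrite leqn0 => /eqP->.
    rewrite leq_eqVlt => /predU1P[->//|]; exact/IHm/it_gt0.
  exists (fun k => (it k).-1); split=> //; first exact/IHf/(it_s 0).
  move=> i lt_i; have := it_s _ (ltnW lt_i); have := it_s _ lt_i.
  rewrite /it /= -/(it i); case: ifP => // _; rewrite -/(it i) => + _.
  exact: IHg.
- rewrite [run _ _ _]/= => /min_search_sound[f1 ltf].
  have f_eq1 w : run c f w = 1 -> eval x f w 0.
    by move=> fw; have := IHf w; rewrite fw; apply.
  split; first exact: f_eq1.
  move=> i /ltf lt_1; exists (run c f (i :: s)).-2.
  have -> : (run c f (i :: s)).-2.+1 = (run c f (i :: s)).-1 by lia.
  by apply: IHf; lia.
Qed.

(** A halting computation uses finitely many oracle bits and search steps. Stating the result for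
    all [n >= N] lets the bounds of subcomputations be combined by a maximum. *)
Lemma run_complete x e s v : eval x e s v ->
  exists N, forall n, N <= n -> run (prefix_code x n) e s = v.+1.
Proof.
elim/recf_nested_ind: e s v => [||i||f gs IHf IHgs|f g IHf IHg|f IHf] s v.
- by move=> ->; exists 0.
- by move=> ->; exists 0.
- by move=> ->; exists 0.
- move=> ->; exists (nth 0 s 0).+1 => n lt_n /=.
  by rewrite trunc_log_code size_mkseq lt_n odd_code ?size_mkseq// nth_mkseq.
- move=> /eval_comp[ws [sz gsw] /IHf[N fN]].
  have [|K gsK] := @uniform_bound (size gs) (fun i K => forall n, K <= n ->
      run (prefix_code x n) (nth RZero gs i) s = (nth 0 ws i).+1) _
      (fun i lt_i => IHgs i lt_i _ _ (gsw i lt_i)).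
    by move=> i k k' le_kk' Pk n le_n; apply: Pk; exact: leq_trans le_n.
  exists (maxn N K) => n; rewrite geq_max => /andP[le_N le_K] /=.
  have -> : [seq run (prefix_code x n) g s | g <- gs] = [seq w.+1 | w <- ws].
    apply: (@eq_from_nth _ 0); rewrite !size_map// => i lt_i.
    by rewrite (nth_map RZero)// (nth_map 0) ?sz// gsK.
  case: ifP => [/mapP[]//|_]; rewrite -map_comp map_id_in//.
  exact: fN.
- case=> h [/IHf[N fN] hS ->].
  have [|K gK] := @uniform_bound (nth 0 s 0) (fun i K => forall n, K <= n ->
      run (prefix_code x n) g [:: i, h i & behead s] = (h i.+1).+1) _
      (fun i lt_i => IHg _ _ (hS i lt_i)).
    by move=> i k k' le_kk' Pk n le_n; apply: Pk; exact: leq_trans le_n.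
  exists (maxn N K) => n; rewrite geq_max => /andP[le_N le_K] /=.
  elim: (nth 0 s 0) gK => [|m IHm] gK /=; first exact: fN.
  rewrite IHm /=; first by rewrite gK.
  by move=> i lt_i; apply: gK; exact: ltnW.
- case=> /IHf[N fN] fS.
  have [||K gK] := @uniform_bound v (fun i K => forall n, K <= n ->
      1 < run (prefix_code x n) f (i :: s)).
  + by move=> i k k' le_kk' Pk n le_n; apply: Pk; exact: leq_trans le_n.
  + move=> i /fS[w /IHf[K wK]]; exists K => n /wK ->//.
  exists (maxn v (maxn N K)) => n; rewrite !geq_max => /and3P[le_v le_N le_K].
  rewrite [LHS]/= (@min_search_complete (fun i => run (prefix_code x n) f (i :: s)) _ v)//.
  - exact: leq_ltn_trans le_v (leq_prefix_code _ _).
  - by rewrite fN.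
  - by move=> i lt_i; exact: gK.
Qed.

(** Both values are the answer of one and the same bounded simulation, which is a function. *)
Lemma eval_inj x e s v w : eval x e s v -> eval x e s w -> v = w.
Proof.
move=> /run_complete[N vN] /run_complete[M wM].
have := vN (maxn N M) (leq_maxl _ _); rewrite wM ?leq_maxr// => -[].
by [].
Qed.

Lemma recursive_run e : recursive (fun _ s => run (nth 0 s 0) e (behead s)).
Proof.
elim/recf_nested_ind: e => [||i||f gs IHf IHgs|f g IHf IHg|f IHf] /=.
- by rec_tac.
- by rec_tac.
- by rec_tac.
- by rec_tac.
- apply: rec_if.
    elim: gs IHgs => [|g gs IHg] IHgs; first exact: rec_const.
    apply: (@rec_ext _ (fun _ s => (run (nth 0 s 0) g (behead s) == 0) ||
        (0 \in [seq run (nth 0 s 0) g0 (behead s) | g0 <- gs]))).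
      by move=> o s; rewrite /= inE eq_sym.
    apply: rec_or; first exact/rec_eq0/(IHgs 0).
    by apply: IHg => i; exact: (IHgs i.+1).
  by rec_tac.
  apply: (rec_subst IHf (l := fun _ s => nth 0 s 0 ::
    [seq w.-1 | w <- [seq run (nth 0 s 0) g (behead s) | g <- gs]])).
  apply: rec_list_cons; first by rec_tac.
  elim: gs IHgs => [|g gs IHg] IHgs; first exact: rec_list_nil.
  apply: rec_list_cons; first exact/rec_pred/(IHgs 0).
  by apply: IHg => i; exact: (IHgs i.+1).
- apply: rec_iteri; first by rec_tac.
    apply: (rec_subst IHf (l := fun _ s => nth 0 s 0 :: behead (behead s)));
      rec_tac.
  apply: rec_if; [by rec_tac..|].
  by apply: (rec_subst IHg (l := fun _ s => nth 0 (behead (behead s)) 0 ::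
    [:: nth 0 s 0, (nth 0 s 1).-1 & behead (behead (behead (behead s)))])); rec_tac.
- apply/rec_pred/rec_iteri; [by rec_tac..|].
  have ff : recursive (fun _ s => run (nth 0 (behead (behead s)) 0) f
      (nth 0 s 0 :: behead (behead (behead s)))).
    by apply: (rec_subst IHf (l := fun _ s => nth 0 (behead (behead s)) 0 ::
      nth 0 s 0 :: behead (behead (behead s)))); rec_tac.
  apply: rec_if; [by rec_tac| |by rec_tac].
  apply: rec_if; [exact: rec_eq0|by rec_tac|].
  apply: rec_if; [|by rec_tac|by rec_tac].
  by apply: rec_eq => //; exact: rec_const.
Qed.

(** * Computable families of reals *)

(** Programs taken from the definitions are specified on lists of one length only, so [e] is
    composed with a list of exactly [k] entries. *)
Lemma rec_eval e k l f : (forall o s, size (l o s) = k) -> recursive_list l ->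
  (forall o s, eval o e (l o s) (f o s)) -> recursive f.
Proof.
move=> sz /choice[gs gsl] ef; exists (RComp e (mkseq gs k)) => o s.
apply/eval_comp; exists (l o s) => //; rewrite sz size_mkseq; split=> // i lt_i.
by rewrite nth_mkseq.
Qed.

Lemma rec_exists (f : seq nat -> nat -> nat) :
  recursive (fun _ s => f (behead s) (nth 0 s 0)) ->
  (forall s, exists i, f s i = 0) ->
  exists m, recursive (fun _ => m) /\ forall s, f s (m s) = 0.
Proof.
move=> ff ex_f; have {}ex_f s : exists i, f s i == 0.
  by have [i /eqP] := ex_f s; exists i.
exists (fun s => ex_minn (ex_f s)); split; last first.
  by move=> s; case: ex_minnP => i /eqP.
apply: (@rec_min (fun _ => f)) => // o s.
case: ex_minnP => i /eqP fi mini; split=> // j lt_ji; rewrite lt0n.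
by apply: contraTneq lt_ji => /eqP/mini; rewrite -leqNgt.
Qed.

Section ComputableReals.
Local Open Scope ring_scope.
Context {R : realType}.
Implicit Types r : seq nat -> R.

(* Signed version of [computes_real], with parameters in a list. *)
Definition creal r : Prop := exists a b : seq nat -> nat,
  [/\ recursive (fun _ => a), recursive (fun _ => b)
    & forall n s, `|r s - ((a (n :: s))%:R - (b (n :: s))%:R) / 2 ^+ n| <= 2 ^- n].

Lemma expr2_gt0 n : 0 < 2 ^+ n :> R. Proof. exact: exprn_gt0. Qed.
Hint Resolve expr2_gt0 : core.

Lemma exprV2_gt0 n : 0 < 2 ^- n :> R. Proof. by rewrite invr_gt0. Qed.
Hint Resolve exprV2_gt0 : core.

(** The quotient is [c * 2 ^ n / 2 ^ d] rounded to a nearest integer, whence an error of at most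
    half of [2 ^- n]. *)
Lemma round_div (c d n : nat) :
  `|c%:R / 2 ^+ d - ((c * 2 ^ n.+1 + 2 ^ d) %/ 2 ^ d.+1)%:R / 2 ^+ n|
    <= 2 ^- n.+1 :> R.
Proof.
set q := (_ %/ _)%N; have := divn_eq (c * 2 ^ n.+1 + 2 ^ d) (2 ^ d.+1).
have := ltn_pmod (c * 2 ^ n.+1 + 2 ^ d) (expn_gt0 2 d.+1 : (0 < 2 ^ d.+1)%N).
rewrite -/q; set m := (_ %% _)%N.
rewrite -(ltr_nat R) => lt_m /(congr1 (fun k => k%:R : R)).
rewrite !natrD !natrM !natrX !exprS in lt_m * => E.
rewrite ler_norml; set u := 2 ^+ d in lt_m E *; set v := 2 ^+ n in E *.
have u0 : 0 < u := expr2_gt0 d; have v0 : 0 < v := expr2_gt0 n.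
have m0 : 0 <= m%:R :> R by [].
have u_neq0 := lt0r_neq0 u0; have v_neq0 := lt0r_neq0 v0.
have -> : c%:R / u - q%:R / v = (m%:R - u) / (2 * v * u).
  have -> : m%:R = c%:R * (2 * v) + u - q%:R * (2 * u) :> R by lra.
  by field; rewrite u_neq0.
have w0 : 0 < 2 * v * u by rewrite !mulr_gt0.
have : - (u / (2 * v * u)) <= (m%:R - u) / (2 * v * u) <= u / (2 * v * u).
  by rewrite -mulNr !ler_pM2r ?invr_gt0//; lra.
suff -> : u / (2 * v * u) = (2 * v)^-1 by [].
by field; rewrite u_neq0 v_neq0.
Qed.

Lemma exprV2_split n : 2 ^- n = 2 ^- n.+1 + 2 ^- n.+1 :> R.
Proof. by rewrite exprS invfM; lra. Qed.

(** With truncated subtraction one of [a - b] and [b - a] is [0], and it rounds to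
    [2 ^ d %/ 2 ^ d.+1 = 0]; only the other one contributes. *)
Lemma round_approx (r : R) (a b d n : nat) :
  `|r - (a%:R - b%:R) / 2 ^+ d| <= 2 ^- n.+1 ->
  `|r - ((((a - b) * 2 ^ n.+1 + 2 ^ d) %/ 2 ^ d.+1)%:R -
         (((b - a) * 2 ^ n.+1 + 2 ^ d) %/ 2 ^ d.+1)%:R) / 2 ^+ n| <= 2 ^- n.
Proof.
wlog le_ba : a b r / (b <= a)%N => [IH|].
  have [|/ltnW le_ab] := leqP b a; first exact: IH.
  have swap (x y z : R) : `|r - (x - y) / z| = `|- r - (y - x) / z|.
    by rewrite -normrN; congr `|_|; ring.
  by rewrite !swap; exact: IH.
move=> rabn; rewrite (_ : (b - a = 0)%N); last by lia.
rewrite mul0n add0n [X in _ - X%:R](divn_small _) ?ltn_exp2l// subr0.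
rewrite [leRHS]exprV2_split; apply: le_trans (_ : `|r - (a%:R - b%:R) / 2 ^+ d| +
  `|(a - b)%:R / 2 ^+ d - (((a - b) * 2 ^ n.+1 + 2 ^ d) %/ 2 ^ d.+1)%:R / 2 ^+ n|
  <= _).
  by apply: le_trans (ler_normD _ _); rewrite natrB// subrKA.
by apply: lerD => //; exact: round_div.
Qed.

(** Approximations may come with any recursive denominator exponent [d]. They are asked for at
    precision [n.+1], which leaves half of the tolerance for rounding to denominator [2 ^ n]. *)
Lemma creal_of_approx r (a b d : seq nat -> nat) :
  recursive (fun _ => a) -> recursive (fun _ => b) -> recursive (fun _ => d) ->
  (forall n s, `|r s - ((a (n :: s))%:R - (b (n :: s))%:R) / 2 ^+ d (n :: s)|
     <= 2 ^- n) ->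
  creal r.
Proof.
move=> ra rb rd rabd.
pose up (l : seq nat) := (nth 0%N l 0).+1 :: behead l.
pose q (a b : seq nat -> nat) l :=
  (((a (up l) - b (up l)) * 2 ^ (nth 0%N l 0).+1 + 2 ^ d (up l)) %/ 2 ^ (d (up l)).+1)%N.
have rup : recursive_list (fun _ => up) by rewrite /up; rec_tac.
exists (q a b), (q b a); split; [rewrite /q; rec_tac..|].
by move=> n s; apply: round_approx; exact: (rabd n.+1 s).
Qed.

Lemma creal_ext r r' : (forall s, r s = r' s) -> creal r' -> creal r.
Proof. by move=> rr' [a [b [? ? rab]]]; exists a, b; split=> // n s; rewrite rr'. Qed.

Lemma creal_subst r (l : seq nat -> seq nat) :
  creal r -> recursive_list (fun _ => l) -> creal (fun s => r (l s)).
Proof.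
move=> [a [b [ra rb rab]]] ll; have lb : recursive_list (fun _ s => l (behead s)).
  by move=> i; apply: (rec_subst (ll i) (l := fun _ s => behead s)); rec_tac.
exists (fun s => a (nth 0%N s 0 :: l (behead s))).
by exists (fun s => b (nth 0%N s 0 :: l (behead s))); split=> //; rec_tac.
Qed.

Lemma creal_nat (f : seq nat -> nat) :
  recursive (fun _ => f) -> creal (fun s => (f s)%:R).
Proof.
move=> ff; exists (fun s => f (behead s) * 2 ^ nth 0%N s 0)%N, (fun=> 0)%N.
split; [by rec_tac..|] => n s /=.
by rewrite subr0 natrM natrX mulfK ?gt_eqF// subrr normr0 ltW.
Qed.

Lemma creal_opp r : creal r -> creal (fun s => - r s).
Proof.
move=> [a [b [ra rb rab]]]; exists b, a; split=> // n s.
rewrite -normrN; apply: le_trans (rab n s).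
by rewrite le_eqVlt; apply/predU1P; left; congr `|_|; ring.
Qed.

Lemma creal_add r1 r2 : creal r1 -> creal r2 -> creal (fun s => r1 s + r2 s).
Proof.
move=> [a1 [b1 [ra1 rb1 rab1]]] [a2 [b2 [ra2 rb2 rab2]]].
pose up s := (nth 0%N s 0).+1 :: behead s.
have rup : recursive_list (fun _ => up) by rewrite /up; rec_tac.
apply: (@creal_of_approx _ (fun s => a1 (up s) + a2 (up s))%N
  (fun s => b1 (up s) + b2 (up s))%N (fun s => (nth 0%N s 0).+1)); [by rec_tac..|].
move=> n s; rewrite /up/= !natrD; have := rab1 n.+1 s; have := rab2 n.+1 s.
rewrite [X in _ -> _ -> _ <= X]exprV2_split.
move: (a1 _) (a2 _) (b1 _) (b2 _) => x1 x2 y1 y2.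
rewrite !ler_norml => /andP[? ?] /andP[? ?].
have -> : (x1%:R + x2%:R - (y1%:R + y2%:R)) / 2 ^+ n.+1 =
  (x1%:R - y1%:R) / 2 ^+ n.+1 + (x2%:R - y2%:R) / 2 ^+ n.+1 :> R by ring.
by apply/andP; split; lra.
Qed.

Lemma creal_sub r1 r2 : creal r1 -> creal r2 -> creal (fun s => r1 s - r2 s).
Proof. by move=> ? ?; exact/creal_add/creal_opp. Qed.

Lemma creal_div_exp2 r (f : seq nat -> nat) : creal r -> recursive (fun _ => f) ->
  creal (fun s => r s / 2 ^+ f s).
Proof.
move=> [a [b [ra rb rab]]] ff.
apply: (@creal_of_approx _ a b (fun s => nth 0%N s 0 + f (behead s))%N) => //.
  by rec_tac.
move=> n s /=; rewrite exprD invfM mulrA -mulrBl normrM.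
rewrite [X in _ * X]gtr0_norm// -[leRHS]mulr1; apply: ler_pM => //.
by rewrite invf_le1// exprn_ege1// ler1n.
Qed.

Lemma creal_exprV2 (f : seq nat -> nat) :
  recursive (fun _ => f) -> creal (fun s => 2 ^- f s).
Proof.
move=> rf; apply: (@creal_ext _ (fun s => 1%:R / 2 ^+ f s)).
  by move=> s; rewrite div1r.
by apply: creal_div_exp2 => //; exact: (creal_nat (rec_const 1)).
Qed.

Lemma creal_if (p : seq nat -> bool) r1 r2 :
  recursive (fun _ s => p s) -> creal r1 -> creal r2 ->
  creal (fun s => if p s then r1 s else r2 s).
Proof.
move=> pp [a1 [b1 [ra1 rb1 rab1]]] [a2 [b2 [ra2 rb2 rab2]]].
exists (fun s => if p (behead s) then a1 s else a2 s).
exists (fun s => if p (behead s) then b1 s else b2 s); split.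
- by apply: rec_if => //; apply: (rec_subst pp (l := fun _ s => behead s)); rec_tac.
- by apply: rec_if => //; apply: (rec_subst pp (l := fun _ s => behead s)); rec_tac.
- by move=> n s /=; case: (p s).
Qed.

(** Precision [n + N] for each of the [N] terms suffices, because [N <= 2 ^ N]. *)
Lemma creal_sum (N : seq nat -> nat) (r : seq nat -> nat -> R) :
  recursive (fun _ => N) -> creal (fun s => r (behead s) (nth 0%N s 0)) ->
  creal (fun s => \sum_(0 <= i < N s) r s i).
Proof.
move=> NN [a [b [ra rb rab]]].
pose l i s := [:: nth 0%N s 0 + N (behead s), i & behead s]%N.
apply: (@creal_of_approx _
  (fun s => \sum_(0 <= i < N (behead s)) a (l i s))%N
  (fun s => \sum_(0 <= i < N (behead s)) b (l i s))%N
  (fun s => nth 0%N s 0 + N (behead s))%N); rewrite /l; [by rec_tac..|].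
move=> n s /=; rewrite !natr_sum -sumrB mulr_suml -sumrB.
apply: le_trans (ler_norm_sum _ _ _) _.
apply: (@le_trans _ _ (\sum_(0 <= i < N s) 2 ^- (n + N s))).
  by apply: ler_sum => i _; exact: (rab _ (i :: s)).
rewrite sumr_const_nat subn0 -[_ *+ N s]mulr_natr exprD invfM -mulrA ler_piMr//.
rewrite mulrC ler_pdivrMr// mul1r -natrX ler_nat.
exact/ltnW/ltn_expl.
Qed.

Lemma creal_lim r (r' : seq nat -> nat -> R) :
  creal (fun s => r' (behead s) (nth 0%N s 0)) ->
  (forall n s, `|r s - r' s n| <= 2 ^- n) -> creal r.
Proof.
move=> [a [b [ra rb rab]]] rr'.
pose up s := [:: (nth 0%N s 0).+1, (nth 0%N s 0).+1 & behead s].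
have rup : recursive_list (fun _ => up) by rewrite /up; rec_tac.
apply: (@creal_of_approx _ (fun s => a (up s)) (fun s => b (up s))
  (fun s => (nth 0%N s 0).+1)); [by rec_tac..|].
move=> n s /=; have := rab n.+1 (n.+1 :: s); have := rr' n.+1 s => /=.
rewrite /up/= => h1 h2; rewrite [leRHS]exprV2_split.
by apply: le_trans (lerD h1 h2); rewrite -[X in `|X|](subrKA (r' s n.+1)) ler_normD.
Qed.

Lemma creal_of_computes e k (l : seq nat -> seq nat) r :
  (forall s, size (l s) = k) -> recursive_list (fun _ => l) ->
  (forall s, computes_real no_oracle e (l s) (r s)) -> creal r.
Proof.
move=> sz ll er.
have /choice[a aP] (s : seq nat) : exists m, eval no_oracle e (rcons (l (behead s)) (nth 0%N s 0)) m
    /\ `|r (behead s) - m%:R / 2 ^+ nth 0%N s 0| <= 2 ^- nth 0%N s 0.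
  by have [m] := er (behead s) (nth 0%N s 0); exists m.
exists a, (fun=> 0%N); split; last 1 first.
- by move=> n s; rewrite subr0; have [_] := aP (n :: s).
- apply: (@rec_eval (strip e) k.+1 (fun _ s => rcons (l (behead s)) (nth 0%N s 0))).
  + by move=> o s; rewrite size_rcons sz.
  + move=> i; have lb : recursive_list (fun _ s => l (behead s)).
      by move=> j; apply: (rec_subst (ll j) (l := fun _ s => behead s)); rec_tac.
    apply: (@rec_ext _ (fun _ s => if i < k then nth 0%N (l (behead s)) i
      else if i == k then nth 0%N s 0 else 0)%N).
      by move=> o s; rewrite nth_rcons sz.
    by case: (i < k)%N; [|case: (i == k)]; rec_tac.
  + by move=> o s; apply/eval_strip; have [] := aP s.
- exact: rec_const.
Qed.

(** Real inequalities are undecidable, so the search tests approximations with a margin. At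
    precision [u = 2 ^- k.+2] it accepts an approximation of at least [- 2 * u]: an [i] with
    [r s i >= - u] passes, and whatever passes has [r s i >= - 3 * u]. *)
Lemma creal_search (r : seq nat -> nat -> R) :
  creal (fun s => r (behead s) (nth 0%N s 0)) ->
  (forall s k, exists i, - 2 ^- k <= r s i) ->
  exists S : seq nat -> nat, recursive (fun _ => S) /\
    forall k s, - 2 ^- k <= r s (S (k :: s)).
Proof.
move=> [a [b [ra rb rab]]] ex_r.
have [|s|S [recS SP]] := @rec_exists (fun s i =>
    a [:: (nth 0%N s 0).+2, i & behead s] + 2 < b [:: (nth 0%N s 0).+2, i & behead s])%N.
- by rec_tac.
- have [i ri] := ex_r (behead s) (nth 0%N s 0).+2; exists i.
  apply/eqP; rewrite eqb0 -leqNgt -(ler_nat R).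
  have := rab (nth 0%N s 0).+2 (i :: behead s); rewrite ler_norml => /andP[_] /=.
  move: (a _) (b _) ri => x y; set u := 2 ^+ _ => ri le_u.
  have u0 : 0 < u by exact: expr2_gt0.
  have : - (2 / u) <= (x%:R - y%:R) / u by lra.
  by rewrite -mulNr ler_pM2r ?invr_gt0// natrD; lra.
exists S; split=> // k s; have /eqP := SP (k :: s).
rewrite eqb0 -leqNgt -(ler_nat R) natrD /=.
have := rab k.+2 (S (k :: s) :: s); rewrite ler_norml => /andP[+ _] /=.
move: (a _) (b _) => x y le_u le_y.
have -> : 2 ^- k = 4 * 2 ^- k.+2 :> R.
  by rewrite !exprS !invfM; field; rewrite gt_eqF.
set u := 2 ^- k.+2 in le_u *; have u0 : 0 < u by exact: exprV2_gt0.
have : - 2 * u <= (x%:R - y%:R) * u by rewrite ler_pM2r//; lra.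
by lra.
Qed.

Lemma creal_measure (mu : {finite_measure set cantor -> \bar R}) :
  computable_measure mu ->
  creal (fun s => fine (mu (cylinder (decode (nth 0%N s 0))))).
Proof.
(* The given program is specified only on codes, which are positive; [maxn] replaces [0] by the code
   [1] of the string that [0] decodes to. *)
move=> [e mue]; apply: (@creal_of_computes e 1 (fun s => [:: maxn (nth 0%N s 0) 1]%N)).
- by [].
- by rec_tac.
- move=> s; have [->|s_gt0] := posnP (nth 0%N s 0); first exact: (mue [::]).
  by rewrite (maxn_idPl s_gt0) -{1}[nth 0%N s 0]decodeK.
Qed.

Lemma computable_of_creal (nu : {finite_measure set cantor -> \bar R}) :
  creal (fun s => fine (nu (cylinder (decode (nth 0%N s 0))))) ->
  computable_measure nu.
Proof.
move=> [a [b [ra rb rab]]].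
have [e ef] : recursive (fun _ s => a [:: nth 0%N s 1; nth 0%N s 0] -
  b [:: nth 0%N s 1; nth 0%N s 0])%N by rec_tac.
exists e => s n; eexists; first exact: ef.
rewrite /=; have := rab n [:: code s]; rewrite /= codeK.
set x := fine _; have x0 : 0 <= x by rewrite fine_ge0.
move: (a _) (b _) => k l; have [le_lk|lt_kl] := leqP l k; first by rewrite natrB.
(* A negative approximation is truncated to [0], which is at least as close to the nonnegative
   value. *)
have -> : (k - l = 0)%N by lia.
rewrite mul0r subr0 (ger0_norm x0); apply: le_trans.
apply: le_trans (ler_norm _); rewrite lerDl -mulNr opprB divr_ge0 ?exprn_ge0//.
by rewrite subr_ge0 ler_nat ltnW.
Qed.

End ComputableReals.

(** * Cantor space *)

Local Open Scope classical_set_scope.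

Lemma tree_path (G : seq bool -> Prop) :
  G [::] -> (forall s, G s -> exists b, G (rcons s b)) ->
  exists x : nat -> bool, forall n, G (mkseq x n).
Proof.
move=> G0 GS; have /choice[f fP] (s : seq bool) : exists b, G s -> G (rcons s b).
  by have [/GS[b]|nG] := pselect (G s); [exists b|exists true => /nG].
pose pth n := iter n (fun s => rcons s (f s)) [::].
exists (fun n => f (pth n)) => n.
suff -> : mkseq (fun n => f (pth n)) n = pth n by elim: n => //= n /fP.
by elim: n => // n IHn; rewrite mkseqS IHn.
Qed.

Lemma prefix_rcons_or (s t : seq bool) : prefix s t -> size s < size t ->
  exists b, prefix (rcons s b) t.
Proof.
move=> /prefixP[[|b u] ->]; first by rewrite cats0 ltnn.
by exists b; rewrite -cat_rcons prefix_prefix.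
Qed.

Lemma prefix_mkseq (x : nat -> bool) m n : m <= n -> prefix (mkseq x m) (mkseq x n).
Proof.
move=> le_mn; rewrite prefixE size_mkseq; apply/eqP.
by rewrite -map_take take_iota (minn_idPl le_mn).
Qed.

(** Compactness of Cantor space. Call a string good if [Q] holds from some length on among its
    extensions. If both children are good then so is the parent, so a bad root would start a path of
    bad strings, although [Q] holds somewhere on every path. *)
Lemma konig (Q : seq bool -> Prop) :
  (forall s t, prefix s t -> Q s -> Q t) ->
  (forall x : nat -> bool, exists n, Q (mkseq x n)) ->
  exists L, forall s, L <= size s -> Q s.
Proof.
move=> Qext Qx; apply: contrapT => nQ.
pose good s := exists L, forall t, prefix s t -> L <= size t -> Q t.
have [||x nG] := @tree_path (fun s => ~ good s).
- by move=> [L QL]; apply: nQ; exists L => s; apply: QL; exact: prefix0s.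
- move=> s ngood; apply: contrapT => ngoodS; apply: ngood.
  have goodS b : good (rcons s b).
    by apply: contrapT => ngood; apply: ngoodS; exists b.
  have [L0 Q0] := goodS false; have [L1 Q1] := goodS true.
  exists (maxn (size s).+1 (maxn L0 L1)) => t st.
  rewrite !geq_max => /and3P[lt_st le0 le1].
  by have [[] bt] := prefix_rcons_or st lt_st; [exact: Q1|exact: Q0].
have [n Qn] := Qx x; apply: (nG n); exists 0%N => t nt _; exact: Qext Qn.
Qed.

Section Cylinders.
Implicit Types (s t : seq bool) (x y : cantor) (A : set cantor).

Lemma cylinder_mkseq x n : cylinder (mkseq x n) x.
Proof. by rewrite /cylinder /= size_mkseq. Qed.

Lemma cylinder_mkseqE x y n :
  cylinder (mkseq x n) y = (mkseq y n = mkseq x n).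
Proof. by rewrite /cylinder /= size_mkseq. Qed.

Lemma cylinder_nil : cylinder [::] = setT.
Proof. by apply/seteqP; split. Qed.

Lemma cylinder_rcons s b :
  cylinder (rcons s b) = cylinder s `&` [set x : cantor | x (size s) = b].
Proof.
apply/seteqP; split=> x; rewrite /cylinder /= size_rcons mkseqS.
  by move/rcons_inj => [-> ->].
by case=> -> ->.
Qed.

Lemma prefix_cylinder s t : prefix s t -> cylinder t `<=` cylinder s.
Proof.
move=> /prefixP[u ->] x; rewrite /cylinder /= size_cat => xsu.
apply/eqP; have := prefix_mkseq x (leq_addr (size u) (size s)).
by rewrite xsu prefixE take_size_cat ?size_mkseq// eq_sym.
Qed.

Lemma open_cylinder s : @open cantor_space (cylinder s).
Proof.
elim/last_ind: s => [|s b IHs]; first by rewrite cylinder_nil; exact: openT.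
rewrite cylinder_rcons; apply: openI => //.
apply: (@open_comp cantor_space bool (fun x => x (size s)) [set b]).
  by move=> x _; exact: (@proj_continuous _ (fun=> bool) (size s) x).
exact: discrete_open.
Qed.

Lemma measurable_cylinder s : measurable (cylinder s : set cantor).
Proof. by apply: sub_sigma_algebra; exact: open_cylinder. Qed.

Lemma measurable_local A :
  (forall x, A x -> exists n, cylinder (mkseq x n) `<=` A) -> measurable A.
Proof.
move=> locA; apply: sub_sigma_algebra.
suff -> : A = \bigcup_(s in [set s | cylinder s `<=` A]) cylinder s.
  by apply: bigcup_open => s _; exact: open_cylinder.
apply/seteqP; split=> [x /[dup] Ax /locA[n nA]|x [s /= sA /sA//]].
by exists (mkseq x n) => //; exact: cylinder_mkseq.
Qed.

Lemma nbhs_cantor (x : cantor_space) (U : set cantor_space) :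
  nbhs x U -> exists n, cylinder (mkseq x n) `<=` U.
Proof.
pose F := filter_from setT (fun n => cylinder (mkseq x n) : set cantor_space).
have FF : Filter F.
  apply: filter_from_filter; first by exists 0.
  move=> i j _ _; exists (maxn i j) => // z zx.
  split; apply: prefix_cylinder zx; apply: prefix_mkseq.
    exact: leq_maxl.
  exact: leq_maxr.
suff Fx : F --> x by move=> /Fx[n _ ?]; exists n.
apply/cvg_sup => i; apply/cvg_image.
  by apply/seteqP; split=> // b _; exists (fun=> b).
move=> V /nbhs_singleton Vx; exists (fun z => V (z i)).
  exists i.+1 => // z; rewrite cylinder_mkseqE !mkseqS.
  by move/rcons_inj => [_ /= ->].
apply/seteqP; split=> [b [z Vz <-]//|b Vb]; by exists (fun=> b).
Qed.

(** Cylinders are indexed by natural numbers, so every open set is a countable union of them. *)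
Lemma measurable_fun_cantor d (X : measurableType d) (f : X -> cantor) :
  (forall s, measurable (f @^-1` cylinder s)) -> measurable_fun setT f.
Proof.
move=> mf; apply: (@measurability _ _ _ _ setT f (@open cantor_space)) => //.
move=> _ [U oU <-]; rewrite setTI.
have -> : U = \bigcup_(n in [set n | cylinder (decode n) `<=` U])
    cylinder (decode n) :> set cantor.
  apply/seteqP; split=> [x Ux|x [n /= nU /nU//]].
  have [n nU] := nbhs_cantor (open_nbhs_nbhs (conj oU Ux)).
  by exists (code (mkseq x n)); rewrite /= codeK//; exact: cylinder_mkseq.
by rewrite preimage_bigcup; apply: bigcup_measurable.
Qed.

End Cylinders.

(** * Measures on Cantor space *)

Local Open Scope ring_scope.

Definition cyl_additive {R : realType} (d : seq bool -> R) : Prop :=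
  forall s, d s = d (rcons s false) + d (rcons s true).

Section Additive.
Context {R : realType}.
Implicit Types d p : seq bool -> R.

Lemma additive_ge0 d L s : cyl_additive d ->
  (forall t, prefix s t -> size t = L -> 0 <= d t) ->
  (size s <= L)%N -> 0 <= d s.
Proof.
move=> addd dL le_sL; have [k def_L] : exists k, L = (size s + k)%N.
  by exists (L - size s)%N; rewrite subnKC.
elim: k s dL def_L {le_sL} => [|k IHk] s dL def_L.
  by apply: dL; rewrite ?def_L ?addn0 ?prefix_refl.
have dS b : 0 <= d (rcons s b).
  apply: IHk; last by rewrite def_L size_rcons addSnnS.
  by move=> t st; apply: dL; exact: prefix_trans (prefix_rcons _ _) st.
by rewrite addd addr_ge0.
Qed.

Lemma additive_sum d L : cyl_additive d ->
  d [::] = \sum_(0 <= i < 2 ^ L) d (decode (2 ^ L + i)).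
Proof.
move=> addd; elim: L => [|L IHL].
  by rewrite expn0 big_nat1 addn0 -[1%N]/(code [::]) codeK.
rewrite IHL expnS mul2n -addnn.
rewrite (big_cat_nat (leq0n _) (leq_addr (2 ^ L) (2 ^ L)))/=.
(* Codes of strings of length [L] fill the range from [2 ^ L] to [2 ^ L.+1]. An appended bit is the
   most significant one, so the children by [false] and by [true] fill the two halves of the next
   range. *)
rewrite -[X in _ + \sum_(X <= _ < _) _]add0n big_addn addnK -big_split/=.
apply: eq_big_nat => i /andP[_ lt_i].
have [s def_s] : exists s, (2 ^ L + i)%N = code s by apply: code_surj; lia.
have sz_s : size s = L.
  by rewrite -trunc_log_code -def_s; apply: trunc_log_eq => //; rewrite expnS; lia.
have codeS (b : bool) : decode (2 ^ L + i + b.+1 * 2 ^ L) = rcons s b.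
  by rewrite -[RHS]codeK code_rcons def_s sz_s.
rewrite [in LHS]def_s codeK addd -2!codeS.
by congr (d (decode _) + d (decode _)); lia.
Qed.

(** * Extension of an additive function on strings to a Borel probability *)

Section Premeasure.
Variable p : seq bool -> R.
Hypotheses (p_ge0 : forall s, 0 <= p s) (p_add : cyl_additive p) (p1 : p [::] = 1).

(* [cylinder s] corresponds to the interval of length [p s] that starts at
   [left_end s], these intervals being laid out in lexicographic order. *)
Definition left_end (s : seq bool) : R :=
  \sum_(0 <= i < size s) if nth false s i then p (rcons (take i s) false) else 0.

Lemma left_end_rcons s b :
  left_end (rcons s b) = left_end s + if b then p (rcons s false) else 0.
Proof.
rewrite /left_end size_rcons big_nat_recr//= nth_rcons ltnn eqxx.
rewrite -cats1 take_size_cat//; congr (_ + _); apply: eq_big_nat => i /andP[_ lt_i].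
by rewrite nth_cat lt_i takel_cat// ltnW.
Qed.

Fixpoint quantile_prefix (u : R) (n : nat) : seq bool :=
  if n is n'.+1 then
    let s := quantile_prefix u n' in
    rcons s (left_end s + p (rcons s false) <= u)
  else [::].

(** Intervals are half open: the bit is [true] once [u] reaches the right end of the interval of the
    left child. For [0 <= u < 1] the result is the sequence all of whose prefixes have [u] in their
    interval. *)
Definition quantile (u : R) : cantor := fun n =>
  let s := quantile_prefix u n in left_end s + p (rcons s false) <= u.

Lemma mkseq_quantile u n : mkseq (quantile u) n = quantile_prefix u n.
Proof. by elim: n => // n IHn; rewrite mkseqS IHn. Qed.

Lemma quantile_cylinder u s b : cylinder s (quantile u) ->
  cylinder (rcons s b) (quantile u) <->
  (left_end s + p (rcons s false) <= u) = b.
Proof.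
rewrite cylinder_rcons /cylinder /= {3}/quantile mkseq_quantile => ->.
by split=> [[]|].
Qed.

Lemma quantile_cylinderP u s : 0 <= u < 1 ->
  cylinder s (quantile u) <-> left_end s <= u < left_end s + p s.
Proof.
move=> u01; elim/last_ind: s => [|s b IHs].
  by rewrite cylinder_nil /left_end big_geq// add0r p1.
rewrite left_end_rcons; have := p_ge0 (rcons s false); have := p_ge0 (rcons s true).
split=> [su|su].
  have s_u : cylinder s (quantile u) by move: su; rewrite cylinder_rcons => -[].
  have /IHs/andP[le_u] := s_u; rewrite p_add.
  by have := (quantile_cylinder b s_u).1 su; case: b {su} => [|/negbT]; lra.
have s_u : cylinder s (quantile u).
  by apply/IHs; rewrite p_add; case: b su => /andP[? ?]; apply/andP; split; lra.
apply/quantile_cylinder => //; case: b su => /andP[? ?]; first lra.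
by apply/negbTE; lra.
Qed.

Lemma measurable_quantile : measurable_fun [set: R] quantile.
Proof.
apply: measurable_fun_cantor; elim/last_ind => [|s b IHs].
  by rewrite cylinder_nil preimage_setT.
have -> : quantile @^-1` cylinder (rcons s b) = quantile @^-1` cylinder s `&`
    [set u | (left_end s + p (rcons s false) <= u) = b].
  apply/seteqP; split=> [u su|u [su]]; last by move=> ub; apply/quantile_cylinder.
  have s_u : cylinder s (quantile u) by move: su; rewrite /= cylinder_rcons => -[].
  by split=> //; apply/quantile_cylinder.
apply: measurableI => //; case: b.
  rewrite (_ : [set _ | _] = `[left_end s + p (rcons s false), +oo[%classic)//.
  by apply/seteqP; split=> u; rewrite /= in_itv/= andbT.
rewrite (_ : [set _ | _] = `]-oo, left_end s + p (rcons s false)[%classic)//.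
by apply/seteqP; split=> u; rewrite /= in_itv/= ltNge; [move/negbT|move/negbTE].
Qed.

(** The image of Lebesgue measure on the half-open unit interval under [quantile]; countable
    additivity is inherited from Lebesgue measure. *)
Definition premeasure_ext (B : set cantor) : \bar R :=
  lebesgue_measure (quantile @^-1` B `&` `[0%R, 1%R[).

Let measurable_pre B : measurable B -> measurable (quantile @^-1` B `&` `[0%R, 1%R[).
Proof.
move=> mB; apply: measurableI => //.
by rewrite -[X in measurable X]setTI; exact: measurable_quantile.
Qed.

Let ext0 : premeasure_ext set0 = 0%E.
Proof. by rewrite /premeasure_ext preimage_set0 set0I measure0. Qed.

Let ext_ge0 B : (0 <= premeasure_ext B)%E.
Proof. exact: measure_ge0. Qed.

Let ext_sigma_additive : semi_sigma_additive premeasure_ext.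
Proof.
move=> F mF tF mUF; rewrite /premeasure_ext preimage_bigcup setI_bigcupl.
apply: measure_semi_sigma_additive.
- by move=> n; exact: measurable_pre.
- move/trivIsetP : tF => tF; apply/trivIsetP => /= i j _ _ ij.
  by rewrite setIACA -preimage_setI tF// preimage_set0 set0I.
- by rewrite -setI_bigcupl -preimage_bigcup; exact: measurable_pre.
Qed.

HB.instance Definition _ := isMeasure.Build _ _ _
  premeasure_ext ext0 ext_ge0 ext_sigma_additive.

Lemma premeasure_ext_cylinder s : premeasure_ext (cylinder s) = (p s)%:E.
Proof.
have sub s' : p s' = p (rcons s' false) + p (rcons s' true) by [].
have bounds : 0 <= left_end s /\ left_end s + p s <= 1.
  elim/last_ind: s => [|s b [IH0 IH1]].
    by rewrite /left_end big_geq// add0r p1.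
  rewrite left_end_rcons; have := p_ge0 (rcons s false); have := p_ge0 (rcons s true).
  by move: IH1; rewrite sub; case: b; split; lra.
rewrite /premeasure_ext.
rewrite (_ : _ `&` _ = `[left_end s, left_end s + p s[%classic).
  rewrite lebesgue_measure_itv/= lte_fin ltrDl; case: ltP => [_|p_le0].
    by rewrite -EFinD addrAC subrr add0r.
  by congr (_%:E); apply/le_anti; rewrite p_ge0 p_le0.
apply/seteqP; split=> u /=; rewrite !in_itv/=.
  by case=> su u01; apply/quantile_cylinderP.
move=> us; have u01 : 0 <= u < 1.
  by case: bounds => ? ?; move: us => /andP[? ?]; apply/andP; split; lra.
by split=> //; apply/quantile_cylinderP.
Qed.

Let ext_setT : premeasure_ext setT = 1%E.
Proof. by rewrite -cylinder_nil premeasure_ext_cylinder p1. Qed.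

HB.instance Definition _ := Measure_isProbability.Build _ _ _
  premeasure_ext ext_setT.

Lemma premeasure_extension : exists nu : probability cantor R,
  forall s, nu (cylinder s) = (p s)%:E.
Proof. by exists premeasure_ext; exact: premeasure_ext_cylinder. Qed.

End Premeasure.

(** * Measures of sets decided by a prefix of fixed length *)

Section MeasureOfCylinders.
Variable mu : {finite_measure set cantor -> \bar R}.

Lemma measurable_decide (D : pred (seq bool)) L :
  measurable [set x : cantor | D (mkseq x L)].
Proof.
apply: measurable_local => x Dx; exists L => y; rewrite cylinder_mkseqE /=.
by move=> ->.
Qed.

Lemma additive_measureI (A : set cantor) : measurable A ->
  cyl_additive (fun s => fine (mu (A `&` cylinder s))).
Proof.
move=> mA s; have mS b : measurable (A `&` cylinder (rcons s b)).
  by apply: measurableI => //; exact: measurable_cylinder.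
rewrite -fineD ?fin_num_measure// -measureU//; last first.
  apply/seteqP; split=> // x [[_ s0] [_ s1]]; move: s0 s1.
  by rewrite !cylinder_rcons => -[_ /= ->] [_].
congr (fine (mu _)); rewrite -setIUr !cylinder_rcons -setIUr; congr (_ `&` _).
apply/seteqP; split=> x; last by case.
by move=> sx; split=> //=; case: (x (size s)); [right|left].
Qed.

Lemma measureI_decide (D : pred (seq bool)) L s : size s = L ->
  mu ([set x : cantor | D (mkseq x L)] `&` cylinder s) =
  if D s then mu (cylinder s) else 0%E.
Proof.
move=> <-; case: ifPn => Ds.
  congr (mu _); apply/seteqP; split=> x; first by case.
  by move=> sx; split=> //=; move: sx; rewrite /cylinder/= => ->.
rewrite (_ : _ `&` _ = set0) ?measure0//; apply/seteqP; split=> // x [/= Dx sx].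
by case/negP: Ds; rewrite -sx.
Qed.

Lemma measure_decide (D : pred (seq bool)) L :
  fine (mu [set x : cantor | D (mkseq x L)]) =
  \sum_(0 <= i < 2 ^ L) if D (decode (2 ^ L + i))
    then fine (mu (cylinder (decode (2 ^ L + i)))) else 0.
Proof.
have mD := measurable_decide D L.
have := additive_sum L (additive_measureI mD); rewrite cylinder_nil setIT => ->.
apply: eq_big_nat => i /andP[_ lt_i]; rewrite measureI_decide.
  by case: ifP.
by rewrite size_decode; apply: trunc_log_eq => //; rewrite expnS; lia.
Qed.

Lemma creal_measure_decide (D : seq nat -> pred (seq bool)) (L : seq nat -> nat) :
  computable_measure mu -> recursive (fun _ => L) ->
  recursive (fun _ s => D (behead s) (decode (nth 0%N s 0))) ->
  creal (fun s => fine (mu [set x : cantor | D s (mkseq x (L s))])).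
Proof.
move=> cmu rL rD.
apply: (creal_ext (fun s => measure_decide (D s) (L s))).
have rL' : recursive (fun _ s => L (behead s)).
  by apply: (rec_subst rL (l := fun _ s => behead s)); rec_tac.
apply: (creal_sum (r := fun s i => if D s (decode (2 ^ L s + i))
  then fine (mu (cylinder (decode (2 ^ L s + i)))) else 0)); first by rec_tac.
apply: creal_if.
- apply: (rec_subst rD (l := fun _ s =>
    (2 ^ L (behead s) + nth 0%N s 0)%N :: behead s)); rec_tac.
- apply: (creal_subst (creal_measure cmu)
    (l := fun s => [:: 2 ^ L (behead s) + nth 0%N s 0]%N)); rec_tac.
- apply: (creal_nat (f := fun=> 0%N)); exact: rec_const.
Qed.

End MeasureOfCylinders.

End Additive.

(** * Hitting times *)

Section HittingTimes.
Local Open Scope nat_scope.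
Variable S : pred (seq bool).

(** The least length of a prefix in [S], the empty prefix included. The value is [(size s).+1] if
    there is none, so comparison with [size s] decides [hit]. *)
Definition hitting (s : seq bool) : nat :=
  find (fun l => S (take l s)) (iota 0 (size s).+1).

Definition hit (s : seq bool) : bool :=
  has (fun l => S (take l s)) (iota 0 (size s).+1).

Lemma hitP s : reflect (exists2 l, l <= size s & S (take l s)) (hit s).
Proof.
apply: (iffP hasP) => [[l]|[l le_l Sl]]; last by exists l; rewrite ?mem_iota.
by rewrite mem_iota => /andP[_ lt_l] Sl; exists l.
Qed.

Lemma hitting_le s : hit s -> hitting s <= size s.
Proof. by rewrite /hit has_find size_iota. Qed.

Lemma hitting_hit s : hit s -> S (take (hitting s) s).
Proof.
move=> hit_s; have := nth_find 0 hit_s; rewrite nth_iota//.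
by rewrite ltnS hitting_le.
Qed.

Lemma hit_prefix s t : prefix s t -> hit s -> hit t /\ hitting t = hitting s.
Proof.
move=> /prefixP[u ->] hit_s.
have eq_take : {in iota 0 (size s).+1,
    (fun l => S (take l (s ++ u))) =1 (fun l => S (take l s))}.
  by move=> l; rewrite mem_iota => /andP[_ lt_l]; rewrite takel_cat.
have sz : (size (s ++ u)).+1 = (size s).+1 + size u by rewrite size_cat.
rewrite /hit /hitting sz iotaD has_cat find_cat.
by rewrite (eq_in_has eq_take) (eq_in_find eq_take) [has _ _]hit_s.
Qed.

Lemma hitting_rcons s b : ~~ hit s -> hit (rcons s b) ->
  hitting (rcons s b) = size (rcons s b).
Proof.
move=> nhit hit_sb; have := hitting_le hit_sb; have := hitting_hit hit_sb.
set l := hitting _ => Sl; rewrite leq_eqVlt => /predU1P[//|].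
rewrite size_rcons ltnS => le_l; case/hitP: nhit; exists l => //.
by move: Sl; rewrite -cats1 takel_cat.
Qed.

End HittingTimes.

Lemma rec_stop_take (S : seq nat -> pred (seq bool)) f g l :
  recursive (fun _ s => S (behead s) (decode (nth 0%N s 0))) ->
  recursive f -> recursive g -> recursive_list l ->
  recursive (fun o s => S (l o s) (take (f o s) (decode (g o s)))).
Proof.
move=> rS rf rg rl.
apply: (@rec_ext _ (fun o s => S (l o s) (decode (code (take (f o s) (decode (g o s))))))).
  by move=> o s; rewrite codeK.
apply: (rec_subst rS (l := fun o s => code (take (f o s) (decode (g o s))) :: l o s)).
by apply: rec_list_cons => //; exact: rec_code_take.
Qed.

Lemma rec_hitting (S : seq nat -> pred (seq bool)) g l :
  recursive (fun _ s => S (behead s) (decode (nth 0%N s 0))) ->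
  recursive g -> recursive_list l ->
  recursive (fun o s => hitting (S (l o s)) (decode (g o s))).
Proof.
move=> rS rg rl.
have lb (l0 : (nat -> bool) -> seq nat -> seq nat) : recursive_list l0 ->
    recursive_list (fun o s => l0 o (behead s)).
  by move=> rl0 i; apply: (rec_subst (rl0 i) (l := fun _ s => behead s)); rec_tac.
apply: (rec_find (n := fun o s => (size (decode (g o s))).+1)
  (p := fun o s i => S (l o s) (take i (decode (g o s))))).
  exact/rec_succ/rec_size_decode.
by apply: rec_stop_take; rec_tac; exact: lb.
Qed.

Lemma rec_hit (S : seq nat -> pred (seq bool)) g l :
  recursive (fun _ s => S (behead s) (decode (nth 0%N s 0))) ->
  recursive g -> recursive_list l ->
  recursive (fun o s => hit (S (l o s)) (decode (g o s))).
Proof.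
move=> rS rg rl.
apply: (@rec_ext _ (fun o s =>
    hitting (S (l o s)) (decode (g o s)) <= size (decode (g o s)))%N).
  by move=> o s; rewrite /hit has_find size_iota.
by apply: rec_leq; [exact: rec_hitting|exact: rec_size_decode].
Qed.

(** * Martingales do not succeed on random sequences *)

Section RealBounds.
Context {R : realType}.

Lemma eq_of_dyadic (x y c : R) :
  (forall n, `|x - y| <= c / 2 ^+ n) -> x = y.
Proof.
move=> xy; apply/eqP; rewrite -subr_eq0 -normr_eq0; apply/eqP/le_anti.
rewrite normr_ge0 andbT leNgt; apply/negP => lt0.
have c_gt0 : 0 < c by rewrite (lt_le_trans lt0)// (le_trans (xy 0%N))// expr0 divr1.
have [n lt_n] : exists n, c / `|x - y| < n%:R.
  by exists (Num.bound (c / `|x - y|)); rewrite archi_boundP// divr_ge0// ltW.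
have := xy n; rewrite leNgt => /negP; apply.
rewrite ltr_pdivrMr ?exprn_gt0// mulrC -ltr_pdivrMr//.
by rewrite (lt_trans lt_n)// -natrX ltr_nat ltn_expl.
Qed.

Lemma sum_exprV2 n : \sum_(0 <= k < n) 2 ^- k.+1 = 1 - 2 ^- n :> R.
Proof.
elim: n => [|n IHn]; first by rewrite big_geq// expr0 invr1 subrr.
by rewrite big_nat_recr//= IHn exprS invfM; lra.
Qed.

End RealBounds.

Section Ville.
Context {R : realType}.
Variable P : {finite_measure set cantor -> \bar R}.
Variable p : nat -> seq bool -> R.
Hypotheses (cP : computable_measure P)
  (p_ge0 : forall k s, 0 <= p k s) (p_add : forall k, cyl_additive (p k))
  (p_nil : forall k, p k [::] <= 2 ^- k.+2)
  (cp : creal (fun s => p (nth 0%N s 0) (decode (nth 0%N s 1)))).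

Let Ps (s : seq bool) : R := fine (P (cylinder s)).

Let Ps_ge0 s : 0 <= Ps s. Proof. exact: fine_ge0. Qed.

Let Ps_add : cyl_additive Ps.
Proof.
by move=> s; have := additive_measureI P measurableT s; rewrite /Ps !setTI.
Qed.

(* Decidable approximation of the event that strategy [k] wins at [s]. *)
Lemma ville_stop : exists S : nat -> pred (seq bool),
  [/\ recursive (fun _ s => S (nth 0%N s 1) (decode (nth 0%N s 0))),
      forall k s, S k s -> (k < size s)%N,
      forall k s, S k s -> Ps s <= p k s + 2 ^- (k.+2 + size s)
    & forall k s, (k < size s)%N -> ~~ S k s -> p k s < Ps s].
Proof.
have [a [b [ra rb rab]]] := cp.
have [a' [b' [ra' rb' rab']]] := creal_measure cP.
pose pr k (s : seq bool) := (k.+4 + size s)%N.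
pose A k s := a [:: pr k s; k; code s]; pose B k s := b [:: pr k s; k; code s].
pose A' k s := a' [:: pr k s; code s]; pose B' k s := b' [:: pr k s; code s].
(* At precision [u = 2 ^- pr k s] acceptance gives [Ps s <= p k s + 4 * u] and rejection gives
   [p k s + u <= Ps s]; the outcomes overlap, which makes the test decidable. The clause
   [k < size s] keeps the number of strategies that can win on a given string finite and excludes a
   win at the root. *)
exists (fun k s => (k < size s)%N && (A' k s + B k s <= A k s + B' k s + 2)%N).
have prE k s : 2 ^- (k.+2 + size s) = 4 * 2 ^- pr k s :> R.
  have -> : pr k s = (k.+2 + size s).+2 by rewrite /pr; lia.
  by rewrite [LHS]exprV2_split [in LHS]exprV2_split; lra.
have approx k s : `|p k s - ((A k s)%:R - (B k s)%:R) * 2 ^- pr k s| <= 2 ^- pr k s.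
  by have := rab (pr k s) [:: k; code s]; rewrite /= codeK.
have approx' k s : `|Ps s - ((A' k s)%:R - (B' k s)%:R) * 2 ^- pr k s| <= 2 ^- pr k s.
  by have := rab' (pr k s) [:: code s]; rewrite /= codeK.
have pos k s : 0 < 2 ^- pr k s :> R by rewrite invr_gt0 exprn_gt0.
split.
- apply: rec_and; first by apply: rec_leq; [rec_tac|apply: rec_size_decode; rec_tac].
  have rc : recursive (fun _ s => code (decode (nth 0%N s 0))).
    apply: (@rec_ext _ (fun _ s => maxn (nth 0 s 0) 1)%N); last by rec_tac.
    move=> _ s; case: (posnP (nth 0%N s 0)) => [->//|s_gt0].
    by rewrite decodeK// (maxn_idPl s_gt0).
  have rs : recursive (fun _ s => size (decode (nth 0%N s 0))).
    by apply: rec_size_decode; rec_tac.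
  by rewrite /A /B /A' /B' /pr; rec_tac.
- by move=> k s /andP[].
- move=> k s /andP[_]; rewrite -(ler_nat R) !natrD prE => le_AB.
  have := approx k s; have := approx' k s; have := pos k s.
  move: (2 ^- pr k s) => u u0; rewrite !ler_norml => /andP[_ le1] /andP[le2 _].
  have : ((A' k s)%:R - (B' k s)%:R) * u <= ((A k s)%:R - (B k s)%:R + 2) * u.
    by rewrite ler_pM2r//; lra.
  by lra.
- move=> k s ->; rewrite /= -ltnNge -(ler_nat R) -addn1 !natrD => lt_AB.
  have := approx k s; have := approx' k s; have := pos k s.
  move: (2 ^- pr k s) => u u0; rewrite !ler_norml => /andP[le1 _] /andP[_ le2].
  have : ((A k s)%:R - (B k s)%:R + 3) * u <= ((A' k s)%:R - (B' k s)%:R) * u.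
    by rewrite ler_pM2r//; lra.
  by lra.
Qed.

Variable S : nat -> pred (seq bool).
Hypotheses (rS : recursive (fun _ s => S (nth 0%N s 1) (decode (nth 0%N s 0))))
  (S_size : forall k s, S k s -> (k < size s)%N)
  (S_le : forall k s, S k s -> Ps s <= p k s + 2 ^- (k.+2 + size s)).

(* [p k] increased by a uniform measure, so that [S k s] implies
   [Ps s <= capital k s], and by a point mass at [000...] that makes the total
   mass exactly [2 ^- k.+1]. *)
Definition capital (k : nat) (s : seq bool) : R :=
  p k s + 2 ^- (k.+2 + size s) +
  if has id s then 0 else 2 ^- k.+2 - p k [::].

Lemma capital_add k : cyl_additive (capital k).
Proof.
move=> s; rewrite /capital p_add !size_rcons -!cats1 !has_cat /= !orbF !orbT.
by rewrite [2 ^- (k.+2 + size s)]exprV2_split !addnS; case: (has id s); lra.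
Qed.

Lemma capital_ge0 k s : 0 <= capital k s.
Proof.
rewrite /capital addr_ge0 ?addr_ge0 ?invr_ge0 ?exprn_ge0//.
by case: (has id s) => //; rewrite subr_ge0.
Qed.

Lemma capital_nil k : capital k [::] = 2 ^- k.+1.
Proof. by rewrite /capital /= addn0 [RHS]exprV2_split; lra. Qed.

(* Once strategy [k] has won at [t], it turns the amount [Ps t] into shares of
   [P]; the rest of its capital is put on the path [t ++ 000...]. *)
Definition wealth (k : nat) (s : seq bool) : R :=
  if hit (S k) s then
    let l := hitting (S k) s in
    Ps s + if has id (drop l s) then 0 else capital k (take l s) - Ps (take l s)
  else capital k s.

Lemma win_le k s : hit (S k) s ->
  Ps (take (hitting (S k) s) s) <= capital k (take (hitting (S k) s) s).
Proof.
move=> /hitting_hit; set t := take _ s => St; have := S_le St; rewrite /capital => le1.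
have : 0 <= if has id t then 0 else 2 ^- k.+2 - p k [::].
  by case: ifP => // _; rewrite subr_ge0.
by lra.
Qed.

(** Shares are bought at the current price: where the strategy first wins, shares and remainder add
    up to its capital. Hence additivity survives the change of regime. *)
Lemma wealth_rcons k s b : ~~ hit (S k) s -> wealth k (rcons s b) = capital k (rcons s b).
Proof.
move=> nhit; rewrite /wealth; case: ifPn => // hit_sb.
by rewrite (hitting_rcons nhit hit_sb) take_size drop_size /= addrC subrK.
Qed.

Lemma wealth_add k : cyl_additive (wealth k).
Proof.
move=> s; have [hit_s|nhit] := boolP (hit (S k) s); last first.
  by rewrite !wealth_rcons// {1}/wealth (negbTE nhit) capital_add.
have hitS b := hit_prefix (prefix_rcons s b) hit_s.
rewrite /wealth hit_s (hitS false).1 (hitS true).1 (hitS false).2 (hitS true).2.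
have := hitting_le hit_s; set l := hitting _ _ => le_l.
rewrite Ps_add -!cats1 !takel_cat// !drop_cat.
have [lt_l|] := ltnP l (size s).
  by rewrite !has_cat /= !orbF !orbT; case: has; lra.
move=> ge_l; have -> : l = size s by apply/eqP; rewrite eqn_leq le_l.
by rewrite subnn /= drop_size/=; lra.
Qed.

Lemma wealth_ge0 k s : 0 <= wealth k s.
Proof.
rewrite /wealth; case: ifPn => hit_s; last exact: capital_ge0.
rewrite addr_ge0//; case: ifP => // _.
by rewrite subr_ge0; exact: win_le.
Qed.

Lemma wealth_win k s : hit (S k) s -> Ps s <= wealth k s.
Proof.
move=> hit_s; rewrite /wealth hit_s lerDl; case: ifP => // _.
by rewrite subr_ge0; exact: win_le.
Qed.

Lemma wealth_nil k : wealth k [::] = 2 ^- k.+1.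
Proof.
rewrite -capital_nil /wealth; case: ifPn => // /hitP[l].
by rewrite leqn0 => /eqP -> /S_size.
Qed.

Lemma wealth_le k s : wealth k s <= 2 ^- k.+1.
Proof.
rewrite -wealth_nil; elim/last_ind: s => // s b IHs; apply: le_trans IHs.
rewrite [leRHS]wealth_add; have := wealth_ge0 k (rcons s false).
by have := wealth_ge0 k (rcons s true); case: b; lra.
Qed.

Lemma creal_capital :
  creal (fun s => capital (nth 0%N s 1) (decode (nth 0%N s 0))).
Proof.
apply: creal_add; first apply: creal_add.
- by apply: (creal_subst cp (l := fun s => [:: nth 0%N s 1; nth 0%N s 0])); rec_tac.
- by apply: creal_exprV2; rec_tac; apply: rec_size_decode; rec_tac.
apply: creal_if.
- apply: (@rec_ext _ (fun _ s => has (nth false (decode (nth 0%N s 0)))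
    (iota 0 (size (decode (nth 0%N s 0)))))).
    move=> _ s; rewrite -{1}[decode _](mkseq_nth false).
    by rewrite /mkseq has_map; congr nat_of_bool; exact: eq_has.
  apply: (rec_has (n := fun _ s => size (decode (nth 0%N s 0)))
    (p := fun _ s => nth false (decode (nth 0%N s 0)))).
    by apply: rec_size_decode; rec_tac.
  by apply: rec_nth_decode; rec_tac.
- exact: (creal_nat (rec_const 0)).
- apply: creal_sub.
    by apply: creal_exprV2; rec_tac.
  by apply: (creal_subst cp (l := fun s => [:: nth 0%N s 1; 1%N])); rec_tac.
Qed.

Lemma creal_Ps (f : seq nat -> nat) : recursive (fun _ => f) ->
  creal (fun s => Ps (decode (f s))).
Proof.
by move=> rf; apply: (creal_subst (creal_measure cP) (l := fun s => [:: f s])); rec_tac.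
Qed.

Lemma creal_wealth :
  creal (fun s => wealth (nth 0%N s 1) (decode (nth 0%N s 0))).
Proof.
pose S' (l : seq nat) := S (nth 0%N l 0).
have rS' : recursive (fun _ s => S' (behead s) (decode (nth 0%N s 0))).
  apply: (@rec_ext _ (fun _ s => S (nth 0%N s 1) (decode (nth 0%N s 0)))) => //.
  by move=> _ s; rewrite /S' nth_behead.
have rh : recursive (fun _ s => hit (S (nth 0%N s 1)) (decode (nth 0%N s 0))).
  by apply: (rec_hit (S := S') (l := fun _ s => [:: nth 0%N s 1])); rec_tac.
pose l s := hitting (S (nth 0%N s 1)) (decode (nth 0%N s 0)).
have rl : recursive (fun _ => l).
  by apply: (rec_hitting (S := S') (l := fun _ s => [:: nth 0%N s 1])); rec_tac.
pose c s := code (take (l s) (decode (nth 0%N s 0))).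
have rc : recursive (fun _ => c) by apply: rec_code_take => //; rec_tac.
apply: creal_if => //; last exact: creal_capital.
apply: creal_add; first by apply: creal_Ps; rec_tac.
apply: creal_if.
- apply: (@rec_ext _ (fun _ s => ~~ all (fun i => (i < l s)%N ||
      ~~ nth false (decode (nth 0%N s 0)) i) (iota 0 (size (decode (nth 0%N s 0)))))).
    move=> _ s; congr nat_of_bool; rewrite -has_predC.
    apply/hasP/hasP => [[b bs /= b1]|[i]].
      have [i] := nthP false bs; rewrite size_drop nth_drop => lt_i ib.
      exists (l s + i)%N; first by rewrite mem_iota /= add0n -ltn_subRL.
      by rewrite /= negb_or -leqNgt leq_addr negbK ib.
    rewrite mem_iota /= negb_or negbK -leqNgt add0n => lt_i /andP[le_l ib].
    exists true => //; rewrite -ib -(subnKC le_l) -nth_drop.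
    by rewrite mem_nth// size_drop ltn_sub2r// (leq_ltn_trans le_l).
  apply/rec_neg/(rec_all (n := fun _ s => size (decode (nth 0%N s 0)))
    (p := fun _ s i => (i < l s)%N || ~~ nth false (decode (nth 0%N s 0)) i)).
    by apply: rec_size_decode; rec_tac.
  apply: rec_or.
    apply: rec_leq; first by rec_tac.
    by apply: (rec_subst rl (l := fun _ s => behead s)); rec_tac.
  by apply/rec_neg/rec_nth_decode; rec_tac.
- exact: (creal_nat (rec_const 0)).
apply: creal_sub.
  apply: (creal_ext (r' := fun s => capital (nth 0%N s 1) (decode (c s)))).
    by move=> s; rewrite /c codeK.
  by apply: (creal_subst creal_capital (l := fun s => [:: c s; nth 0%N s 1])); rec_tac.
apply: (creal_ext (r' := fun s => Ps (decode (c s)))).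
  by move=> s; rewrite /c codeK.
exact: creal_Ps.
Qed.

Let partial (s : seq bool) (n : nat) : R := \sum_(0 <= k < n) wealth k s.

Definition total_wealth (s : seq bool) : R := limn (partial s).

(** Strategy [k] never holds more than [2 ^- k.+1], so all strategies from [n] on hold at most
    [2 ^- n]. Additivity, total mass and computability pass to the limit through this bound. *)
Lemma total_wealth_bounds s n :
  0 <= total_wealth s - partial s n <= 2 ^- n.
Proof.
have partial_mono m : (n <= m)%N -> partial s n <= partial s m <= partial s n + 2 ^- n.
  move=> le_nm; rewrite /partial (big_cat_nat (leq0n _) le_nm)/= lerDl sumr_ge0 => [|i _].
    rewrite lerD2l; apply: (@le_trans _ _ (\sum_(n <= i < m) 2 ^- i.+1)).
      by apply: ler_sum => i _; exact: wealth_le.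
    have := sum_exprV2 (R := R) m; rewrite (big_cat_nat (leq0n _) le_nm)/= sum_exprV2.
    have : 0 <= 2 ^- m :> R by rewrite invr_ge0 exprn_ge0.
    by lra.
  exact: wealth_ge0.
have nd : {homo partial s : m k / (m <= k)%N >-> m <= k}.
  move=> m k le_mk; rewrite /partial (big_cat_nat (leq0n _) le_mk)/= lerDl sumr_ge0// => i _.
  exact: wealth_ge0.
have cvg_partial : cvgn (partial s).
  apply: nondecreasing_is_cvgn => //; exists 1 => _ [m _ <-].
  apply: (@le_trans _ _ (\sum_(0 <= i < m) 2 ^- i.+1)).
    by apply: ler_sum => i _; exact: wealth_le.
  by rewrite sum_exprV2 gerBl invr_ge0 exprn_ge0.
rewrite subr_ge0 lerBlDl; apply/andP; split.
  apply: limr_ge => //; exists n => // m /= le_nm.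
  by have /andP[] := partial_mono m le_nm.
apply: limr_le => //; exists n => // m /= le_nm.
by have /andP[] := partial_mono m le_nm.
Qed.

Lemma total_wealth_ge0 s : 0 <= total_wealth s.
Proof. by have := total_wealth_bounds s 0; rewrite /partial big_geq// subr0 => /andP[]. Qed.

Lemma total_wealth_add : cyl_additive total_wealth.
Proof.
move=> s; apply: (@eq_of_dyadic _ _ _ 3) => n.
have := total_wealth_bounds s n; have := total_wealth_bounds (rcons s false) n.
have := total_wealth_bounds (rcons s true) n.
have -> : partial s n = partial (rcons s false) n + partial (rcons s true) n.
  by rewrite /partial -big_split/=; apply: eq_bigr => k _; exact: wealth_add.
move: (2 ^- n) => u /andP[? ?] /andP[? ?] /andP[? ?].
by rewrite ler_norml; apply/andP; split; lra.
Qed.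

Lemma total_wealth_nil : total_wealth [::] = 1.
Proof.
apply: (@eq_of_dyadic _ _ _ 1) => n; have := total_wealth_bounds [::] n.
rewrite /partial (eq_bigr (fun k => 2 ^- k.+1)) => [|k _]; last exact: wealth_nil.
rewrite sum_exprV2 ler_norml div1r; move: (2 ^- n) => u /andP[? ?].
by apply/andP; split; lra.
Qed.

Lemma creal_total_wealth : creal (fun s => total_wealth (decode (nth 0%N s 0))).
Proof.
apply: (creal_lim (r' := fun s n => partial (decode (nth 0%N s 0)) n)); last first.
  move=> n s; have /andP[ge0 le_n] := total_wealth_bounds (decode (nth 0%N s 0)) n.
  by rewrite ger0_norm.
apply: (creal_sum (N := fun s => nth 0%N s 0)
  (r := fun s i => wealth i (decode (nth 0%N (behead s) 0)))); first by rec_tac.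
apply: (creal_ext (r' := fun s => wealth (nth 0%N s 0) (decode (nth 0%N s 2)))).
  by move=> s; rewrite !nth_behead.
by apply: (creal_subst creal_wealth (l := fun s => [:: nth 0%N s 2; nth 0%N s 0])); rec_tac.
Qed.

(** All strategies that have won on [s] are counted, since by [S_size] none with [k >= size s] can
    have. Each of them holds at least [Ps s], so the count is bounded by the density of the total
    wealth relative to [P]. *)
Definition wins (s : seq bool) : nat := \sum_(0 <= k < size s) hit (S k) s.

Lemma wins_prefix s t : prefix s t -> (wins s <= wins t)%N.
Proof.
move=> st; have le_st : (size s <= size t)%N by exact: size_prefix.
rewrite /wins (big_cat_nat (leq0n _) le_st)/=; apply: leq_trans (leq_addr _ _).
apply: leq_sum => k _; case: (boolP (hit (S k) s)) => // hit_s.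
by rewrite (hit_prefix st hit_s).1.
Qed.

Lemma wins_le s : (wins s)%:R * Ps s <= total_wealth s.
Proof.
have /andP[+ _] := total_wealth_bounds s (size s); rewrite subr_ge0; apply: le_trans.
rewrite /wins natr_sum mulr_suml; apply: ler_sum => k _.
case: (boolP (hit (S k) s)) => hit_s; first by rewrite mul1r wealth_win.
by rewrite mul0r wealth_ge0.
Qed.

(** The test is the number of strategies that ever win along [x]; increments present it as a sum of
    computable functions. *)
Definition wins_increment (l : nat) (x : cantor) : R :=
  (wins (mkseq x l.+1) - wins (mkseq x l))%:R.

Lemma sum_wins_increment (x : cantor) n :
  \sum_(0 <= l < n) wins_increment l x = (wins (mkseq x n))%:R.
Proof.
elim: n => [|n IHn]; first by rewrite /wins !big_geq.
rewrite big_nat_recr//= IHn /wins_increment -natrD subnKC//.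
exact/wins_prefix/prefix_mkseq.
Qed.

Lemma measurable_wins_increment l (D : set cantor) :
  measurable_fun D (fun x : cantor => (wins_increment l x)%:E).
Proof.
suff mT : measurable_fun [set: cantor] (fun x : cantor => (wins_increment l x)%:E).
  exact: measurable_funS measurableT (@subsetT _ D) mT.
move=> _ B mB; rewrite setTI.
apply: measurable_local => x Bx; exists l.+1 => z.
rewrite cylinder_mkseqE => zx; have zx' : mkseq z l = mkseq x l.
  by move: zx; rewrite !mkseqS => /rcons_inj[].
by move: Bx; rewrite /preimage /= /wins_increment zx zx'.
Qed.

Lemma computable_wins_increment : computable_fun_seq wins_increment.
Proof.
split=> [k x|]; first exact: ler0n.
pose S' (l : seq nat) := S (nth 0%N l 0).
have rS' : recursive (fun _ s => S' (behead s) (decode (nth 0%N s 0))).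
  apply: (@rec_ext _ (fun _ s => S (nth 0%N s 1) (decode (nth 0%N s 0)))) => //.
  by move=> _ s; rewrite /S' nth_behead.
have rw f : recursive f -> recursive (fun o s => wins (decode (f o s))).
  move=> rf; apply: (rec_sum (n := fun o s => size (decode (f o s)))
    (f := fun o s i => hit (S i) (decode (f o s)))); first exact: rec_size_decode.
  apply: (rec_hit (S := S') (l := fun _ s => [:: nth 0%N s 0])); rec_tac.
have [e ef] : recursive (fun o s =>
    (wins (decode (code (mkseq o (nth 0 s 0).+1))) -
     wins (decode (code (mkseq o (nth 0 s 0))))) * 2 ^ nth 0 s 1)%N.
  apply: rec_mul; last by rec_tac.
  by apply: rec_sub; apply: rw;
    apply: (rec_code_mkseq (p := fun o _ i => o i)); rec_tac; apply: rec_oracle; rec_tac.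
exists e => k x n; eexists; first exact: ef.
rewrite !codeK [nth 0%N _ 0]/= [nth 0%N _ 1]/= natrM natrX /wins_increment.
by rewrite mulfK ?gt_eqF ?exprn_gt0// subrr normr0 invr_ge0 exprn_ge0.
Qed.

(** Both sides are additive in [s], so it suffices to compare them on strings of length [n], where
    the integrand is constant and [wins_le] applies. *)
Lemma integral_wins s n : (size s <= n)%N ->
  (\int[P]_(x in cylinder s) (wins (mkseq x n))%:R%:E <= (total_wealth s)%:E)%E.
Proof.
move=> le_sn; have mS k : measurable [set x : cantor | hit (S k) (mkseq x n)].
  exact: measurable_decide.
have -> : (fun x : cantor => ((wins (mkseq x n))%:R : R)%:E) =
    (fun x : cantor => \sum_(0 <= k < n) (\1_[set x : cantor | hit (S k) (mkseq x n)] x)%:E)%E.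
  apply/funext => x; rewrite sumEFin /wins size_mkseq natr_sum; congr (_%:E).
  apply: eq_bigr => k _; rewrite indicE; congr (_%:R); congr nat_of_bool.
  by apply/idP/idP; rewrite inE.
have ms := measurable_cylinder s.
rewrite ge0_integral_sum//; last first.
  by move=> k; apply/measurable_EFinP; exact: measurable_indic.
rewrite (eq_bigr (fun k =>
    (fine (P ([set x : cantor | hit (S k) (mkseq x n)] `&` cylinder s)))%:E)); last first.
  by move=> k _; rewrite integral_indic// fineK// fin_num_measure//; exact: measurableI.
rewrite sumEFin lee_fin -subr_ge0.
pose d t := total_wealth t -
  \sum_(0 <= k < n) fine (P ([set x : cantor | hit (S k) (mkseq x n)] `&` cylinder t)).
rewrite -/(d s); apply: (@additive_ge0 _ d n) => //.
  move=> t; rewrite /d total_wealth_add.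
  rewrite (eq_bigr _ (fun k _ => additive_measureI P (mS k) t)) big_split/=.
  by rewrite opprD addrACA.
move=> t _ szt; rewrite /d subr_ge0; apply: le_trans (wins_le t).
rewrite /wins szt natr_sum mulr_suml; apply: ler_sum => k _.
rewrite (measureI_decide P (hit (S k)) szt).
by case: ifP => _; rewrite ?mul1r ?mul0r.
Qed.

(** The number of strategies that win along a sequence is a test bounded by the probability
    extending [total_wealth]. It is finite at [y], so some strategy never wins there. *)
Lemma ville_hit (y : cantor) : computably_random P y ->
  exists k, forall n, ~~ hit (S k) (mkseq y n).
Proof.
move=> randy; have [nu nuE] := premeasure_extension total_wealth_ge0
  total_wealth_add total_wealth_nil.
pose t x := (\sum_(0 <= l <oo) (wins_increment l x)%:E)%E.
have w_ge0 l x : 0 <= wins_increment l x by exact: ler0n.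
have ty : (t y < +oo)%E; first apply: (randy t nu).
- exists wins_increment; [exact: computable_wins_increment|by []].
- apply: computable_of_creal; apply: creal_ext creal_total_wealth => s.
  exact: (congr1 fine (nuE _)).
- move=> s; rewrite nuE /t; have ms := measurable_cylinder s.
  rewrite integral_nneseries//; last 2 first.
    by move=> l; exact: measurable_wins_increment.
    by move=> l x _; rewrite lee_fin.
  apply: lime_le.
    by apply: is_cvg_nneseries => l _ _; apply: integral_ge0 => x _; rewrite lee_fin.
  exists (size s) => // n /= le_sn; rewrite -ge0_integral_sum//; last 2 first.
    by move=> l; exact: measurable_wins_increment.
    by move=> l x _; rewrite lee_fin.
  apply: le_trans (integral_wins le_sn); rewrite le_eqVlt; apply/predU1P; left.
  by apply: eq_integral => x _; rewrite sumEFin sum_wins_increment.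
apply: contrapT => all_hit.
have {all_hit} hit_k k : exists n, hit (S k) (mkseq y n).
  apply: contrapT => nhit; apply: all_hit; exists k => n; apply/negP => hit_n.
  by apply: nhit; exists n.
have wins_unbounded B : exists n, (B <= wins (mkseq y n))%N.
  have [||N hitN] := @uniform_bound B (fun k n => hit (S k) (mkseq y n)).
  - move=> k n n' le_nn' hit_n.
    by have [] := hit_prefix (prefix_mkseq y le_nn') hit_n.
  - by move=> k _; exact: hit_k.
  exists (maxn B N); rewrite /wins size_mkseq.
  rewrite (big_cat_nat (leq0n _) (leq_maxl B N))/=; apply: leq_trans (leq_addr _ _).
  apply: (@leq_trans (\sum_(0 <= k < B) 1)).
    by rewrite sum_nat_const_nat subn0 muln1.
  rewrite big_nat [leqRHS]big_nat.
  apply: leq_sum => k lt_k.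
  by have [->] := hit_prefix (prefix_mkseq y (leq_maxr B N)) (hitN k lt_k).
have t_ge n : (((wins (mkseq y n))%:R : R)%:E <= t y)%E.
  by rewrite -sum_wins_increment -sumEFin; apply: nneseries_lim_ge => l _ _; rewrite lee_fin.
have t_ge0 : (0 <= t y)%E by apply: le_trans (t_ge 0%N); rewrite lee_fin.
have [n] := wins_unbounded (Num.bound (fine (t y))).
apply/negP; rewrite -ltnNge -(ltr_nat R); apply: le_lt_trans (archi_boundP (fine_ge0 t_ge0)).
by rewrite -lee_fin fineK// ge0_fin_numE.
Qed.

End Ville.

(* Strategy [k] starts with capital [p k [::]] and wins at [s] when its capital
   reaches [P (cylinder s)]; only finitely many of them win along [y]. *)
Lemma ville {R : realType} (P : {finite_measure set cantor -> \bar R})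
    (p : nat -> seq bool -> R) (y : cantor) :
  computable_measure P -> computably_random P y ->
  (forall k s, 0 <= p k s) -> (forall k, cyl_additive (p k)) ->
  (forall k, p k [::] <= 2 ^- k.+2) ->
  creal (fun s => p (nth 0%N s 0) (decode (nth 0%N s 1))) ->
  exists k, forall n, (k < n)%N ->
    p k (mkseq y n) < fine (P (cylinder (mkseq y n))).
Proof.
move=> cP randy p_ge0 p_add p_nil cp.
have [S [rS S_size S_le S_gt]] := ville_stop cP cp.
have [k nhit] := ville_hit cP p_ge0 p_add p_nil cp rS S_size S_le randy.
exists k => n lt_kn; apply: S_gt; first by rewrite size_mkseq.
have := nhit n; apply: contra => Sn; apply/hitP; exists n; first by rewrite size_mkseq.
by rewrite take_oversize ?size_mkseq.
Qed.

(** * Total extension of a map computable on an effectively closed set *)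

Section TotalExtension.
Variables (C : nat -> set cantor) (F : nat -> cantor -> cantor) (eC eF : recf).
Hypotheses (eCP : forall n x, ~ C n x <-> exists s, cylinder s x /\
                  exists v, eval no_oracle eC [:: n; code s] v)
  (eFP : forall n x, C n x -> forall k, eval x eF [:: n; k] (F n x k)).

(** Every prefix of [s] is tried as a witness. Since [strip eC] asks no oracle, [code s] acts only
    as a bound on searches. *)
Definition leaves (m : nat) (s : seq bool) : bool :=
  has (fun l => (0 < run (code s) (strip eC) [:: m; code (take l s)])%N)
    (iota 0 (size s).+1).

Lemma leavesP m (x : cantor) : ~ C m x <-> exists n, leaves m (mkseq x n).
Proof.
split=> [/eCP[s [sx [v eCv]]]|[n /hasP[l _]]].
  have [N runN] := run_complete (((eval_strip x eC _ _).2 eCv)).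
  exists (maxn N (size s)); apply/hasP; exists (size s).
    by rewrite mem_iota size_mkseq /= add0n ltnS leq_maxr.
  have -> : take (size s) (mkseq x (maxn N (size s))) = s.
    have := prefix_mkseq x (leq_maxr N (size s)).
    by rewrite prefixE size_mkseq (sx : mkseq x _ = s) => /eqP.
  by rewrite runN// leq_maxl.
move=> /(@run_sound x) /eval_strip eCv; apply/eCP.
exists (take l (mkseq x n)); split; last by eexists; exact: eCv.
exact: prefix_cylinder (prefix_take _ _) _ (cylinder_mkseq _ _).
Qed.

Lemma leaves_notin m (x : cantor) n : leaves m (mkseq x n) -> ~ C m x.
Proof. by move=> lv; apply/leavesP; exists n. Qed.

Lemma rec_leaves f g : recursive f -> recursive g ->
  recursive (fun o s => leaves (f o s) (decode (g o s))).
Proof.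
move=> rf rg; have rr := recursive_run (strip eC).
apply: (rec_has (n := fun o s => (size (decode (g o s))).+1) (p := fun o s l =>
  (0 < run (code (decode (g o s))) (strip eC)
    [:: f o s; code (take l (decode (g o s)))])%N)).
  exact/rec_succ/rec_size_decode.
have lb h : recursive h -> recursive (fun o s => h o (behead s)).
  by move=> rh; apply: (rec_subst rh (l := fun _ s => behead s)); rec_tac.
have rf' := lb _ rf; have rg' := lb _ rg.
have rc : recursive (fun o s => code (decode (g o (behead s)))).
  apply: (@rec_ext _ (fun o s => code (take (size (decode (g o (behead s))))
    (decode (g o (behead s)))))); first by move=> o s; rewrite take_size.
  by apply: rec_code_take => //; exact: rec_size_decode.
apply: rec_leq; first exact: rec_const.
apply: (rec_subst rr (l := fun o s => [:: code (decode (g o (behead s)));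
  f o (behead s); code (take (nth 0%N s 0) (decode (g o (behead s))))])).
by rec_tac; apply: rec_code_take; rec_tac.
Qed.

(* The bit [k] of [total_map m x] is that of [F m x], unless [x] is seen to leave
   [C m] before that bit has been computed, in which case it is [false]. *)
Definition decided (m k : nat) (s : seq bool) : bool :=
  leaves m s || (0 < run (code s) eF [:: m; k])%N.

(** The bit is read at the first decided prefix, so longer prefixes cannot change it. The result [2]
    of [run] codes the answer [1], that is [true]. *)
Definition phi_bit (m k : nat) (s : seq bool) : bool :=
  let t := take (hitting (decided m k) s) s in
  ~~ leaves m t && (run (code t) eF [:: m; k] == 2).

Definition total_map (m : nat) (x : cantor) : cantor := fun k =>
  `[< exists n, hit (decided m k) (mkseq x n) && phi_bit m k (mkseq x n) >].

Lemma hit_decided m k (x : nat -> bool) : exists n, hit (decided m k) (mkseq x n).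
Proof.
suff [n dn] : exists n, decided m k (mkseq x n).
  by exists n; apply/hitP; exists n; rewrite ?take_oversize ?size_mkseq.
have [Cx|/leavesP[n]] := pselect (C m x); last by exists n; rewrite /decided; apply/orP; left.
have [n runn] := run_complete (eFP Cx k).
by exists n; rewrite /decided runn// orbT.
Qed.

Lemma phi_bit_prefix m k s t : prefix s t -> hit (decided m k) s ->
  phi_bit m k t = phi_bit m k s.
Proof.
move=> st hit_s; have [_ eq_h] := hit_prefix st hit_s; rewrite /phi_bit eq_h.
suff -> : take (hitting (decided m k) s) t = take (hitting (decided m k) s) s by [].
by move: st => /prefixP[u ->]; rewrite takel_cat// hitting_le.
Qed.

Lemma PhiE m k (x : cantor) n : hit (decided m k) (mkseq x n) ->
  total_map m x k = phi_bit m k (mkseq x n).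
Proof.
move=> hitn; apply/asboolP/idP => [[i /andP[hiti biti]]|bitn]; last first.
  by exists n; rewrite hitn.
rewrite -(phi_bit_prefix (prefix_mkseq x (leq_maxr i n)) hitn).
by rewrite (phi_bit_prefix (prefix_mkseq x (leq_maxl i n)) hiti).
Qed.

Lemma Phi_F m (x : cantor) : C m x -> total_map m x = F m x.
Proof.
move=> Cx; apply/funext => k; have [n hitn] := hit_decided m k x.
rewrite (PhiE hitn) /phi_bit; have := hitting_hit hitn.
have -> : take (hitting (decided m k) (mkseq x n)) (mkseq x n) =
    mkseq x (hitting (decided m k) (mkseq x n)).
  have := prefix_mkseq x (hitting_le hitn).
  by rewrite prefixE size_mkseq size_mkseq => /eqP.
set i := hitting _ _; have -> /= : leaves m (mkseq x i) = false.
  by apply/negbTE/negP => /leaves_notin.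
rewrite /decided => /orP[/leaves_notin//|run_gt0].
have := eval_inj (run_sound run_gt0) (eFP Cx k); move: run_gt0.
by case: (run _ _ _) => // v _ /= ->; case: (F m x k).
Qed.

Definition ready (m K : nat) (s : seq bool) : bool :=
  all (fun k => hit (decided m k) s) (iota 0 K).

Lemma rec_decided : recursive (fun _ s =>
  decided (nth 0%N s 1) (nth 0%N s 2) (decode (nth 0%N s 0))).
Proof.
apply: rec_or; first by apply: rec_leaves; rec_tac.
have rc : recursive (fun o s => code (decode (nth 0%N s 0))).
  apply: (@rec_ext _ (fun o s => code (take (size (decode (nth 0%N s 0)))
    (decode (nth 0%N s 0))))); first by move=> o s; rewrite take_size.
  by apply: rec_code_take; rec_tac; apply: rec_size_decode; rec_tac.
apply: rec_leq; first exact: rec_const.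
apply: (rec_subst (recursive_run eF) (l := fun o s =>
  [:: code (decode (nth 0%N s 0)); nth 0%N s 1; nth 0%N s 2])); rec_tac.
Qed.

Let decided' l := decided (nth 0%N l 0) (nth 0%N l 1).

Let rec_decided' :
  recursive (fun _ s => decided' (behead s) (decode (nth 0%N s 0))).
Proof.
apply: rec_ext rec_decided => _ s.
by rewrite /decided' !nth_behead.
Qed.

Lemma rec_hit_decided f g h : recursive f -> recursive g -> recursive h ->
  recursive (fun o s => hit (decided (f o s) (g o s)) (decode (h o s))).
Proof.
move=> rf rg rh.
by apply: (rec_hit rec_decided' (l := fun o s => [:: f o s; g o s])); rec_tac.
Qed.

Lemma rec_phi_bit f g h : recursive f -> recursive g -> recursive h ->
  recursive (fun o s => phi_bit (f o s) (g o s) (decode (h o s))).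
Proof.
move=> rf rg rh.
pose c o s := code (take (hitting (decided (f o s) (g o s)) (decode (h o s)))
  (decode (h o s))).
have rc : recursive c.
  apply: rec_code_take => //.
  by apply: (rec_hitting rec_decided' (l := fun o s => [:: f o s; g o s])); rec_tac.
apply: (@rec_ext _ (fun o s => ~~ leaves (f o s) (decode (c o s)) &&
    (run (c o s) eF [:: f o s; g o s] == 2))).
  by move=> o s; rewrite /c codeK.
apply: rec_and; first by apply/rec_neg/rec_leaves.
apply: rec_eq; last exact: rec_const.
by apply: (rec_subst (recursive_run eF) (l := fun o s => [:: c o s; f o s; g o s])); rec_tac.
Qed.

Lemma ready_prefix m K s t : prefix s t -> ready m K s -> ready m K t.
Proof.
by move=> st /allP rs; apply/allP => k /rs hs; have [] := hit_prefix st hs.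
Qed.

(** Compactness provides a length at which all strings are ready. Readiness of all [2 ^ L] strings
    of length [L] is decidable, so such a length can be searched for: this is a recursive modulus of
    uniform continuity for [total_map]. *)
Lemma ready_bound : exists L : seq nat -> nat, recursive (fun _ => L) /\
  forall l s, (L l <= size s)%N -> ready (nth 0%N l 0) (nth 0%N l 1) s.
Proof.
have [||L [rL LP]] := @rec_exists (fun l L => ~~ all (fun i =>
    all (fun k => hit (decided (nth 0%N l 0) k) (decode (2 ^ L + i)))
      (iota 0 (nth 0%N l 1))) (iota 0 (2 ^ L))).
- apply: rec_neg; apply: (rec_all (n := fun _ s => (2 ^ nth 0%N s 0)%N)
    (p := fun _ s i => all (fun k => hit (decided (nth 0%N (behead s) 0) k)
      (decode (2 ^ nth 0%N s 0 + i))) (iota 0 (nth 0%N (behead s) 1)))).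
    by rec_tac.
  apply: (rec_all (n := fun _ s => nth 0%N (behead (behead s)) 1)
    (p := fun _ s k => hit (decided (nth 0%N (behead (behead s)) 0) k)
      (decode (2 ^ nth 0%N (behead s) 0 + nth 0%N s 0)))); first by rec_tac.
  by apply: rec_hit_decided; rec_tac.
- move=> l; have [||L readyL] := @konig (fun s => ready (nth 0%N l 0) (nth 0%N l 1) s).
  + by move=> s t st; exact: ready_prefix.
  + move=> x; have [||N hitN] := @uniform_bound (nth 0%N l 1)
      (fun k n => hit (decided (nth 0%N l 0) k) (mkseq x n)).
    * by move=> k n n' le_nn' hn; have [] := hit_prefix (prefix_mkseq x le_nn') hn.
    * by move=> k _; exact: hit_decided.
    exists N; apply/allP => k; rewrite mem_iota => /andP[_ lt_k]; exact: hitN.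
  exists L; apply/eqP; rewrite eqb0 negbK; apply/allP => i.
  rewrite mem_iota => /andP[_ lt_i]; apply: readyL.
  have {}lt_i : (i < 2 ^ L)%N by [].
  rewrite size_decode (@trunc_log_eq 2 L)//.
  by rewrite leq_addr expnS mul2n -addnn ltn_add2l.
exists L; split=> // l s le_Ls.
apply: (@ready_prefix _ _ (take (L l) s)); first exact: prefix_take.
have /eqP := LP l; rewrite eqb0 negbK => /allP allL.
have sz : size (take (L l) s) = L l by rewrite size_takel.
have /andP[ge_c lt_c] := code_bounds (take (L l) s); rewrite sz in ge_c lt_c.
have := allL (code (take (L l) s) - 2 ^ L l)%N.
rewrite mem_iota /= add0n subnKC// codeK; apply.
by rewrite ltn_subLR// addnn -mul2n -expnS.
Qed.

Definition agree (m : nat) (t s : seq bool) : bool :=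
  all (fun k => phi_bit m k s == nth false t k) (iota 0 (size t)).

Lemma rec_agree f g h : recursive f -> recursive g -> recursive h ->
  recursive (fun o s => agree (f o s) (decode (g o s)) (decode (h o s))).
Proof.
move=> rf rg rh; have lb h0 : recursive h0 -> recursive (fun o s => h0 o (behead s)).
  by move=> rh0; apply: (rec_subst rh0 (l := fun _ s => behead s)); rec_tac.
apply: (rec_all (n := fun o s => size (decode (g o s)))
  (p := fun o s k => phi_bit (f o s) k (decode (h o s)) ==
    nth false (decode (g o s)) k)); first exact: rec_size_decode.
apply: rec_eqb; first by apply: rec_phi_bit; [exact: lb|rec_tac|exact: lb].
by apply: rec_nth_decode; [exact: lb|rec_tac].
Qed.

Lemma Phi_cylinder m t (x : cantor) n : ready m (size t) (mkseq x n) ->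
  cylinder t (total_map m x) <-> agree m t (mkseq x n).
Proof.
move=> /allP rdy; have bitE k : (k < size t)%N -> total_map m x k = phi_bit m k (mkseq x n).
  by move=> lt_k; apply: PhiE; apply: rdy; rewrite mem_iota.
split=> [tx|/allP agr].
  apply/allP => k; rewrite mem_iota => /andP[_ lt_k].
  by rewrite -bitE// -(tx : mkseq _ _ = _) nth_mkseq.
apply: (@eq_from_nth _ false); rewrite size_mkseq// => k lt_k.
by rewrite nth_mkseq// bitE//; apply/eqP/agr; rewrite mem_iota.
Qed.

Lemma Phi_continuous m (x : cantor) k :
  exists n, forall z, cylinder (mkseq x n) z -> mkseq (total_map m z) k = mkseq (total_map m x) k.
Proof.
have [L [_ /(_ [:: m; k]) rdy]] := ready_bound; exists (L [:: m; k]) => z.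
rewrite cylinder_mkseqE => zx.
have rz : ready m k (mkseq z (L [:: m; k])) by apply: rdy; rewrite size_mkseq.
have := @Phi_cylinder m (mkseq (total_map m x) k) z (L [:: m; k]).
rewrite size_mkseq => /(_ rz)[_]; rewrite zx cylinder_mkseqE; apply.
apply/(@Phi_cylinder m (mkseq (total_map m x) k)); last exact: cylinder_mkseq.
by rewrite size_mkseq -zx.
Qed.

Lemma measurable_Phi m t : measurable (total_map m @^-1` cylinder t).
Proof.
apply: measurable_local => x tx; have [n nx] := Phi_continuous m x (size t).
by exists n => z /nx zx; rewrite /= /cylinder /= zx.
Qed.

(** * Computability of the measures of preimages, for any computable measure *)

Section CylinderMeasure.
Context {R : realType}.
Variable kappa : {finite_measure set cantor -> \bar R}.
Hypothesis ckappa : computable_measure kappa.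

(* The parameter list [s] is [:: m; code t; j; n]. *)
Lemma creal_Phi_leaves : creal (fun s => fine (kappa
  (total_map (nth 0%N s 0) @^-1` cylinder (decode (nth 0%N s 1)) `&`
   [set x : cantor | hit (leaves (nth 0%N s 2)) (mkseq x (nth 0%N s 3))]))).
Proof.
have [L [rL LP]] := ready_bound.
pose N s := maxn (L [:: nth 0%N s 0; size (decode (nth 0%N s 1))]) (nth 0%N s 3).
pose D s t := agree (nth 0%N s 0) (decode (nth 0%N s 1)) t &&
  hit (leaves (nth 0%N s 2)) (take (nth 0%N s 3) t).
apply: (@creal_ext _ _ (fun s => fine (kappa [set x : cantor | D s (mkseq x (N s))]))).
  move=> s; congr (fine (kappa _)).
  have le3 : (nth 0%N s 3 <= N s)%N by exact: leq_maxr.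
  have rdy (x : cantor) : ready (nth 0%N s 0) (size (decode (nth 0%N s 1))) (mkseq x (N s)).
    by apply: (LP [:: _; _]); rewrite size_mkseq leq_maxl.
  have takeE (x : cantor) : take (nth 0%N s 3) (mkseq x (N s)) = mkseq x (nth 0%N s 3).
    by have := prefix_mkseq x le3; rewrite prefixE size_mkseq => /eqP.
  apply/seteqP; split=> x /=; rewrite /D takeE.
    by case=> /(Phi_cylinder (rdy x)) -> ->.
  by case/andP => /(Phi_cylinder (rdy x)).
apply: creal_measure_decide => //.
  rewrite /N; apply: rec_max; last by rec_tac.
  by apply: (rec_subst rL (l := fun _ s => [:: nth 0%N s 0; size (decode (nth 0%N s 1))]));
    rec_tac; apply: rec_size_decode; rec_tac.
rewrite /D; apply: rec_and; first by apply: rec_agree; rec_tac.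
apply: (@rec_ext _ (fun _ s => hit (leaves (nth 0%N (behead s) 2))
    (decode (code (take (nth 0%N (behead s) 3) (decode (nth 0%N s 0))))))).
  by move=> _ s; rewrite codeK.
apply: (rec_hit (S := fun l => leaves (nth 0%N l 0)) (l := fun _ s => [:: nth 0%N (behead s) 2])).
- by apply: rec_leaves; rec_tac.
- by apply: rec_code_take; rec_tac.
- by rec_tac.
Qed.

Lemma creal_Phi : creal (fun s => fine (kappa
  (total_map (nth 0%N s 0) @^-1` cylinder (decode (nth 0%N s 1))))).
Proof.
have [L [rL LP]] := ready_bound.
pose N s := L [:: nth 0%N s 0; size (decode (nth 0%N s 1))].
apply: (@creal_ext _ _ (fun s => fine (kappa
    [set x : cantor | agree (nth 0%N s 0) (decode (nth 0%N s 1)) (mkseq x (N s))]))).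
  move=> s; congr (fine (kappa _)).
  have rdy (x : cantor) : ready (nth 0%N s 0) (size (decode (nth 0%N s 1))) (mkseq x (N s)).
    by apply: (LP [:: _; _]); rewrite size_mkseq.
  by apply/seteqP; split=> x /(Phi_cylinder (rdy x)).
apply: (creal_measure_decide (D := fun s => agree (nth 0%N s 0) (decode (nth 0%N s 1)))) => //.
  by apply: (rec_subst rL (l := fun _ s => [:: nth 0%N s 0; size (decode (nth 0%N s 1))]));
    rec_tac; apply: rec_size_decode; rec_tac.
by apply: rec_agree; rec_tac.
Qed.

Lemma creal_leaves : creal (fun s => fine (kappa
  [set x : cantor | hit (leaves (nth 0%N s 0)) (mkseq x (nth 0%N s 1))])).
Proof.
apply: (creal_measure_decide (D := fun s => hit (leaves (nth 0%N s 0)))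
  (L := fun s => nth 0%N s 1)) => //; first by rec_tac.
apply: (rec_hit (S := fun l => leaves (nth 0%N l 0)) (l := fun _ s => [:: nth 0%N (behead s) 0])).
- by apply: rec_leaves; rec_tac.
- by rec_tac.
- by rec_tac.
Qed.

End CylinderMeasure.

End TotalExtension.

(** * Tests *)

(** Programs embed into finite trees labelled by natural numbers, which form a countable type. *)
Lemma recf_enumeration : exists u : nat -> recf, forall e, exists i, u i = e.
Proof.
pose enc := fix enc (e : recf) : GenTree.tree nat :=
  match e with
  | RZero => GenTree.Leaf 0
  | RSucc => GenTree.Leaf 1
  | ROracle => GenTree.Leaf 2
  | RProj i => GenTree.Leaf i.+3
  | RComp f gs => GenTree.Node 0 (enc f :: map enc gs)
  | RPrim f g => GenTree.Node 1 [:: enc f; enc g]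
  | RMin f => GenTree.Node 2 [:: enc f]
  end.
have enc_inj : injective enc.
  elim/recf_nested_ind => [||i||f gs IHf IHgs|f g IHf IHg|f IHf]
    [||i'||f' gs'|f' g'|f'] //=.
  - by case=> ->.
  - case=> /IHf -> eq_gs; congr (RComp f' _).
    have sz : size gs = size gs' by rewrite -(size_map enc) eq_gs size_map.
    apply: (@eq_from_nth _ RZero) => // i lt_i; apply: IHgs => //.
    by rewrite -!(nth_map _ (enc RZero)) -?sz// eq_gs.
  - by case=> /IHf -> /IHg ->.
  - by case=> /IHf ->.
pose num e := pickle (enc e).
have num_inj e e' : num e = num e' -> e = e'.
  by move=> /(pcan_inj (@pickleK _))/enc_inj.
have /choice[u uP] (i : nat) : exists e, (exists e', num e' = i) -> num e = i.
  by have [[e ei]|ni] := pselect (exists e, num e = i); [exists e|exists RZero].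
by exists u => e; exists (num e); apply/num_inj/uP; exists e.
Qed.

(** * Real-valued estimates for finite measures *)

Section FineMeasure.
Context {R : realType}.
Variable mu : {finite_measure set cantor -> \bar R}.
Implicit Types A B D : set cantor.

Lemma fine_measure_le A B : measurable A -> measurable B -> A `<=` B ->
  fine (mu A) <= fine (mu B).
Proof.
move=> mA mB AB; rewrite fine_le ?fin_num_measure//.
by apply: le_measure; rewrite ?inE.
Qed.

Lemma fine_measureU_le A B : measurable A -> measurable B ->
  fine (mu (A `|` B)) <= fine (mu A) + fine (mu B).
Proof.
move=> mA mB; rewrite -fineD ?fin_num_measure// fine_le//.
- by rewrite fin_num_measure//; exact: measurableU.
- by rewrite fin_numD !fin_num_measure.
- exact: measureU2.
Qed.

Lemma fine_measure_split A B : measurable A -> measurable B ->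
  fine (mu A) = fine (mu (A `&` B)) + fine (mu (A `\` B)).
Proof.
move=> mA mB; rewrite -fineD ?fin_num_measure//; [|exact: measurableI|exact: measurableD].
by rewrite [in LHS](measureDI mu mA mB) addeC.
Qed.

Lemma fine_measure_dist A B D : measurable A -> measurable B -> measurable D ->
  A `&` D = B `&` D -> `|fine (mu A) - fine (mu B)| <= fine (mu (~` D)).
Proof.
move=> mA mB mD AB; rewrite (fine_measure_split mA mD) (fine_measure_split mB mD) AB.
have leD X : measurable X -> fine (mu (X `\` D)) <= fine (mu (~` D)).
  move=> mX; apply: fine_measure_le; [exact: measurableD|exact: measurableC|].
  by move=> x [].
have := leD _ mA; have := leD _ mB.
have := fine_ge0 (measure_ge0 mu (A `\` D)); have := fine_ge0 (measure_ge0 mu (B `\` D)).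
by rewrite ler_norml => *; apply/andP; split; lra.
Qed.

Lemma additive_preimage D (f : cantor -> cantor) :
  (forall t, measurable (D `&` f @^-1` cylinder t)) ->
  cyl_additive (fun t => fine (mu (D `&` f @^-1` cylinder t))).
Proof.
move=> mf t; rewrite -fineD ?fin_num_measure// -measureU//; last first.
  rewrite setIACA setIid -preimage_setI (_ : cylinder _ `&` _ = set0).
    by rewrite preimage_set0 setI0.
  by apply/seteqP; split=> // x; rewrite !cylinder_rcons => -[[_ /= ->] [_]].
congr (fine (mu _)); rewrite -setIUr -preimage_setU !cylinder_rcons.
congr (_ `&` f @^-1` _); apply/seteqP; split=> x; last by case=> -[].
by move=> tx; case xt : (x (size t)); [right|left].
Qed.

End FineMeasure.

(** * Semicontinuity and measurability of tests *)

Section LowerSemicomputable.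
Context {R : realType}.

Lemma computes_real_inj x e s (r r' : R) :
  computes_real x e s r -> computes_real x e s r' -> r = r'.
Proof.
move=> er er'; apply: (@eq_of_dyadic _ _ _ 2) => n.
have [k ek rk] := er n; have [k' ek' rk'] := er' n.
move: rk'; rewrite -(eval_inj ek ek') => rk'.
rewrite -(subrKA (k%:R / 2 ^+ n)); apply: le_trans (ler_normD _ _) _.
by rewrite (distrC _ r') mulrDl mul1r lerD.
Qed.

(** An approximation is computed from finitely many bits of [x], and every [z] that shares them gets
    the same approximation. *)
Lemma computes_real_continuous e s (g : cantor -> R) (x : cantor) n :
  (forall z, computes_real z e s (g z)) ->
  exists k, forall z, cylinder (mkseq x k) z -> `|g z - g x| <= 2 / 2 ^+ n.
Proof.
move=> eg; have [v ev gv] := eg x n; have [k runk] := run_complete ev.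
exists k => z; rewrite cylinder_mkseqE => zx.
have evz : eval z e (rcons s n) v.
  have := @run_sound z k e (rcons s n); rewrite zx runk//=; exact.
have [w ew gw] := eg z n; move: gw; rewrite (eval_inj ew evz) => gw.
rewrite -(subrKA (v%:R / 2 ^+ n)); apply: le_trans (ler_normD _ _) _.
by rewrite (distrC _ (g x)) mulrDl mul1r lerD.
Qed.

Lemma exprV2_lt (e : R) : 0 < e -> exists n, 2 / 2 ^+ n < e.
Proof.
move=> e0; exists (Num.bound (2 / e)); rewrite ltr_pdivrMr ?exprn_gt0//.
rewrite mulrC -ltr_pdivrMr//; apply: lt_trans (archi_boundP _) _.
  by rewrite divr_ge0// ltW.
by rewrite -natrX ltr_nat ltn_expl.
Qed.

(** Exceeding [B] is already witnessed by a finite partial sum, which is continuous because its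
    terms are computable. *)
Lemma lower_semicomputable_open (t : cantor -> \bar R) (x : cantor) (B : R) :
  lower_semicomputable t -> (B%:E < t x)%E ->
  exists n, forall z, cylinder (mkseq x n) z -> (B%:E < t z)%E.
Proof.
move=> [g [g0 [e eg]] tE]; rewrite tE => Bt.
have gE0 z k : (0 <= (g k z)%:E)%E by rewrite lee_fin.
have [N BN] : exists N, B < \sum_(0 <= k < N) g k x.
  apply: contrapT => nB; move: Bt; rewrite ltNge => /negP; apply.
  apply: lime_le; first exact: is_cvg_nneseries.
  apply: nearW => N; rewrite sumEFin lee_fin leNgt; apply/negP => BN.
  by apply: nB; exists N.
have cont M (d : R) : 0 < d -> exists n, forall z, cylinder (mkseq x n) z ->
    `|\sum_(0 <= k < M) g k z - \sum_(0 <= k < M) g k x| < d.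
  elim: M d => [|M IHM] d d0.
    by exists 0 => z _; rewrite !big_geq// subrr normr0.
  have d20 : 0 < d / 2 by rewrite divr_gt0.
  have [n nP] := IHM _ d20; have [p p_lt] := exprV2_lt d20.
  have [k kP] := computes_real_continuous x p (eg M).
  exists (maxn n k) => z zx; rewrite !big_nat_recr//= opprD addrACA.
  have zn := nP z (prefix_cylinder (prefix_mkseq x (leq_maxl n k)) zx).
  have zk := kP z (prefix_cylinder (prefix_mkseq x (leq_maxr n k)) zx).
  apply: le_lt_trans (ler_normD _ _) _.
  by rewrite [ltRHS]splitr ltrD// (le_lt_trans zk).
have gap : 0 < \sum_(0 <= k < N) g k x - B by rewrite subr_gt0.
have [n nP] := cont N _ gap.
exists n => z /nP; rewrite ltr_norml => /andP[lt1 _]; rewrite tE.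
apply: (@lt_le_trans _ _ (\sum_(0 <= k < N) (g k z)%:E)%E); last exact: nneseries_lim_ge.
by rewrite sumEFin lte_fin; lra.
Qed.

Lemma lower_semicomputable_measurable (t : cantor -> \bar R) (D : set cantor) :
  lower_semicomputable t -> measurable_fun D t.
Proof.
move=> lt; suff mT : measurable_fun [set: cantor] t.
  exact: measurable_funS measurableT (@subsetT _ D) mT.
apply: (measurability _ (ErealGenOInfty.measurableE R)) => // _ [_ [B ->] <-].
rewrite setTI; apply: measurable_local => x /=; rewrite in_itv/= andbT => Bx.
have [n nP] := lower_semicomputable_open lt Bx.
by exists n => z /nP; rewrite /= in_itv/= andbT.
Qed.

Lemma lower_semicomputable_integral (mu : {finite_measure set cantor -> \bar R})
    (t : cantor -> \bar R) (B : R) s : lower_semicomputable t -> 0 <= B ->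
  (forall z, cylinder s z -> (B%:E <= t z)%E) ->
  (B%:E * mu (cylinder s) <= \int[mu]_(z in cylinder s) t z)%E.
Proof.
move=> lt B0 Bt; have ms := measurable_cylinder s.
rewrite -integral_cst//; apply: ge0_le_integral => //.
- exact: lower_semicomputable_measurable.
Qed.

End LowerSemicomputable.

(** * Schnorr layerwise computable maps *)

Section SchnorrLayerwise.
Context {R : realType}.
Variables (mu : {finite_measure set cantor -> \bar R}) (T : partial_map).
Variables (C : nat -> set cantor) (F : nat -> cantor -> cantor) (eC eF : recf).
Hypotheses (mu1 : mu setT = 1%E) (cmu : computable_measure mu)
  (eCP : forall n x, ~ C n x <-> exists s, cylinder s x /\
                  exists v, eval no_oracle eC [:: n; code s] v)
  (eFP : forall n x, C n x -> forall k, eval x eF [:: n; k] (F n x k))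
  (muC : forall n, ((1 - 2 ^- n)%:E <= mu (C n))%E)
  (cC : computable_real_seq (fun n => fine (mu (C n))))
  (CT : forall n x, C n x -> pdom T x /\ F n x = T x).

Local Notation Phi := (total_map eC eF).
Local Notation P := (ppushforward mu T).

Lemma measurable_C n : measurable (C n).
Proof.
rewrite -(setCK (C n)); apply: measurableC; apply: measurable_local => x.
move=> /(leavesP eCP)[k lv]; exists k => z; rewrite cylinder_mkseqE => zx.
by apply: (leaves_notin eCP (n := k)); rewrite zx.
Qed.

Lemma fine_muCC n : fine (mu (C n)) + fine (mu (~` C n)) = 1.
Proof.
have mC := measurable_C n; have := fine_measure_split mu measurableT mC.
rewrite setTI setTD => <-; exact: (congr1 fine mu1).
Qed.

Lemma mu_CC_le n : fine (mu (~` C n)) <= 2 ^- n.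
Proof.
have := fine_muCC n; have := muC n.
rewrite -[mu (C n)]fineK ?fin_num_measure//; last exact: measurable_C.
by rewrite lee_fin; lra.
Qed.

Lemma measurable_ppreimage_cylinder t : measurable (ppreimage T (cylinder t)).
Proof.
exact: measurable_pfun (measurable_pdom T) _ (measurable_cylinder t).
Qed.

Lemma ppreimage_Phi m t :
  ppreimage T (cylinder t) `&` C m = Phi m @^-1` cylinder t `&` C m.
Proof.
apply/seteqP; split=> x [tx Cx]; split=> //.
  by rewrite /= (Phi_F eCP eFP Cx) (CT Cx).2; case: tx.
have [dx FT] := CT Cx; split=> //.
by move: tx; rewrite /= (Phi_F eCP eFP Cx) FT.
Qed.

(** On [C n] the maps [T] and [Phi n] agree, so their preimages of a cylinder differ in measure by
    at most [2 ^- n]. *)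
Lemma computable_ppushforward : computable_measure (ppushforward mu T).
Proof.
apply: computable_of_creal.
apply: (creal_lim (r' := fun s n => fine (mu
    (Phi n @^-1` cylinder (decode (nth 0%N s 0)))))).
  apply: (creal_ext (r' := fun s => fine (mu
      (Phi (nth 0%N s 0) @^-1` cylinder (decode (nth 0%N s 1)))))).
    by move=> s; rewrite nth_behead.
  exact: (creal_Phi eCP eFP cmu).
move=> n s; apply: le_trans (mu_CC_le n).
exact: (fine_measure_dist mu (measurable_ppreimage_cylinder _)
  (measurable_Phi eCP eFP _ _) (measurable_C n) (ppreimage_Phi n _)).
Qed.

(** Passing to [hit] makes these clopen approximations of the complement of [C m] increase with [n]
    by construction. *)
Let left (m n : nat) : set cantor := [set x : cantor | hit (leaves eC m) (mkseq x n)].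

Let measurable_left m n : measurable (left m n).
Proof. exact: measurable_decide. Qed.

Lemma left_sub m n : left m n `<=` ~` C m.
Proof.
move=> x /hitP[l]; rewrite size_mkseq => le_ln lv.
apply: (leaves_notin eCP (n := l)).
by have := prefix_mkseq x le_ln; rewrite prefixE size_mkseq => /eqP <-.
Qed.

Lemma left_exhaust m k : exists n, fine (mu (~` C m)) - 2 ^- k <= fine (mu (left m n)).
Proof.
have cupE : \bigcup_n left m n = ~` C m.
  apply/seteqP; split=> [x [n _]|x /(leavesP eCP)[n lv]]; first exact: left_sub.
  by exists n => //; apply/hitP; exists n; rewrite ?take_oversize ?size_mkseq.
have mCC : measurable (~` C m) by apply: measurableC; exact: measurable_C.
have nd : nondecreasing_seq (left m).
  move=> i j le_ij; apply/subsetPset => x hx.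
  by have [] := hit_prefix (prefix_mkseq x le_ij) hx.
have := nondecreasing_cvg_mu (mu := mu) (measurable_left m) _ nd.
rewrite cupE => /(_ mCC); rewrite -[X in _ --> X]fineK ?fin_num_measure// => /fine_cvg.
move/cvgrPdist_le => /(_ (2 ^- k)); rewrite invr_gt0 exprn_gt0// => /(_ isT)[n _ /(_ n (leqnn n))].
by rewrite ler_norml => /andP[_ le_n]; exists n; move: le_n => /=; lra.
Qed.

(** Two errors of [2 ^- n.+1] are allowed: one for replacing [T] by [Phi n.+1], the other for
    replacing the complement of the layer by a clopen part of it. Knowing the measure of the layer
    tells when that part is large enough. *)
Lemma creal_ppreimage_setD : creal (fun s => fine (mu
  (ppreimage T (cylinder (decode (nth 0%N s 1))) `\` C (nth 0%N s 0)))).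
Proof.
have [eM eMP] := cC.
have cMC : creal (fun s => fine (mu (C (nth 0%N s 0)))).
  by apply: (creal_of_computes (k := 1) (e := eM) (l := fun s => [:: nth 0%N s 0])) => //; rec_tac.
(* This function is minus the measure of the part of the complement of the layer that is not yet
   enumerated at stage [n]. *)
have [||S [rS SP]] := creal_search (r := fun s n =>
    fine (mu (left (nth 0%N s 0) n)) + fine (mu (C (nth 0%N s 0))) - 1).
- apply: creal_sub; last exact: (creal_nat (rec_const 1)).
  apply: creal_add.
    apply: (creal_subst (creal_leaves eC cmu)
      (l := fun s => [:: nth 0%N (behead s) 0; nth 0%N s 0])); rec_tac.
  by apply: (creal_subst cMC (l := fun s => [:: nth 0%N (behead s) 0])); rec_tac.
- move=> s k; have [n le_n] := left_exhaust (nth 0%N s 0) k; exists n.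
  by have := fine_muCC (nth 0%N s 0); lra.
apply: (creal_lim (r' := fun s n => fine (mu
  (Phi n.+1 @^-1` cylinder (decode (nth 0%N s 1)) `&`
   left (nth 0%N s 0) (S [:: n.+1; nth 0%N s 0]))))).
  apply: (creal_subst (creal_Phi_leaves eCP eFP cmu)
    (l := fun s => [:: (nth 0%N s 0).+1; nth 0%N (behead s) 1; nth 0%N (behead s) 0;
       S [:: (nth 0%N s 0).+1; nth 0%N (behead s) 0]])); rec_tac.
move=> n s; set t := decode _; set j := nth 0%N s 0; set i := S _.
have mT := measurable_ppreimage_cylinder t; have mPhi := measurable_Phi eCP eFP n.+1 t.
have mCn := measurable_C n.+1; have mCj := measurable_C j; have ml := measurable_left j i.
have ml2 : fine (mu (~` C j `\` left j i)) <= 2 ^- n.+1.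
  have := SP n.+1 [:: j]; rewrite -/i /=; have := fine_muCC j.
  have := fine_measure_split mu (measurableC mCj) ml.
  rewrite (_ : ~` C j `&` left j i = left j i); first lra.
  by rewrite setIC; apply/setIidPl; exact: left_sub.
have mD1 : measurable (ppreimage T (cylinder t) `\` C j) by exact: measurableD.
have mD2 : measurable (Phi n.+1 @^-1` cylinder t `&` left j i) by exact: measurableI.
have mE : measurable (~` C j `\` left j i).
  by apply: measurableD => //; exact: measurableC.
have mCnC := measurableC mCn.
apply: le_trans (fine_measure_dist mu mD1 mD2
  (D := ~` (~` C n.+1 `|` (~` C j `\` left j i))) _ _) _.
- by apply: measurableC; apply: measurableU.
- have eqP := ppreimage_Phi n.+1 t.
  apply/seteqP; split=> x [[tx xj] /not_orP[/contrapT Cx nE]].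
    have lx : left j i x by apply: contrapT => nl; apply: nE; split.
    have [px _] : (Phi n.+1 @^-1` cylinder t `&` C n.+1) x by rewrite -eqP.
    by split=> // -[//|]; exact: nE.
  have [px _] : (ppreimage T (cylinder t) `&` C n.+1) x by rewrite eqP.
  split; first by split=> //; exact: left_sub xj.
  by case=> [//|]; exact: nE.
rewrite setCK; apply: le_trans (fine_measureU_le mu mCnC mE) _.
by rewrite [leRHS]exprV2_split lerD// mu_CC_le.
Qed.

Variable y : cantor.
Hypothesis randy : computably_random (ppushforward mu T) y.

Let Py n : R := fine (P (cylinder (mkseq y n))).

(** Strategy [k] bets on twice the mass outside layer [k.+3]; its initial capital is at most
    [2 * 2 ^- k.+3], the budget [2 ^- k.+2] of [ville]. A strategy that does not win on [y] yields
    the layer. *)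
Lemma layer_bound : exists m N, forall n, (N < n)%N ->
  fine (mu (ppreimage T (cylinder (mkseq y n)) `\` C m)) +
  fine (mu (ppreimage T (cylinder (mkseq y n)) `\` C m)) < Py n.
Proof.
pose q j t := fine (mu (ppreimage T (cylinder t) `\` C j)).
have qE j t : q j t = fine (mu ((pdom T `\` C j) `&` T @^-1` cylinder t)).
  by rewrite /q /ppreimage setIDAC setIDA.
have q_add j : cyl_additive (q j).
  move=> t; rewrite !qE; apply: (@additive_preimage _ mu (pdom T `\` C j) T) => {}t.
  rewrite setIDAC setIDA; apply: measurableD; last exact: measurable_C.
  exact: measurable_ppreimage_cylinder.
have q_ge0 j t : 0 <= q j t by exact: fine_ge0.
have [||||k kP] := ville (p := fun k t => q k.+3 t + q k.+3 t) (y := y)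
  computable_ppushforward randy.
- by move=> k s; rewrite addr_ge0.
- by move=> k s; rewrite q_add addrACA.
- move=> k; rewrite [leRHS]exprV2_split; suff le_q : q k.+3 [::] <= 2 ^- k.+3 by rewrite lerD.
  apply: le_trans (mu_CC_le _); apply: fine_measure_le.
  + apply: measurableD; last exact: measurable_C.
    exact: measurable_ppreimage_cylinder.
  + by apply: measurableC; exact: measurable_C.
  + by move=> x [].
- have cq : creal (fun s => q (nth 0%N s 0).+3 (decode (nth 0%N s 1))).
    by apply: (creal_subst creal_ppreimage_setD
      (l := fun s => [:: (nth 0%N s 0).+3; nth 0%N s 1])); rec_tac.
  exact: creal_add.
by exists k.+3, k.
Qed.

(** The strict inequality of [layer_bound] gives positivity for large [n], and [Py] is
    nonincreasing. *)
Lemma Py_gt0 n : 0 < Py n.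
Proof.
have [m [N NP]] := layer_bound.
have : 0 < Py (maxn n N.+1).
  apply: le_lt_trans (NP _ _); first by rewrite addr_ge0// fine_ge0.
  by rewrite leq_max ltnSn orbT.
move=> /lt_le_trans; apply; apply: fine_measure_le; try exact: measurable_cylinder.
by apply: prefix_cylinder; apply: prefix_mkseq; rewrite leq_maxl.
Qed.

(** Strategy [k] bets on the image of [kappa] scaled by [2 ^- k.+2], which settles all [n > k] for
    some [k]. For [n <= k] the image has mass at most [1] while [Py n >= Py k.+1 > 0]; hence the
    minimum taken as [a]. *)
Lemma Py_ge m (kappa : {finite_measure set cantor -> \bar R}) :
  kappa setT = 1%E -> computable_measure kappa ->
  exists2 a : R, 0 < a & forall n,
    a * fine (kappa (Phi m @^-1` cylinder (mkseq y n))) <= Py n.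
Proof.
move=> kappa1 ck; pose q t := fine (kappa (Phi m @^-1` cylinder t)).
have q_ge0 t : 0 <= q t by exact: fine_ge0.
have mPhi t : measurable (Phi m @^-1` cylinder t) by exact: (measurable_Phi eCP eFP).
have q_le1 t : q t <= 1.
  rewrite -(_ : fine (kappa setT) = 1); last by rewrite kappa1.
  exact: fine_measure_le.
have q_add : cyl_additive q.
  have qE t : q t = fine (kappa (setT `&` Phi m @^-1` cylinder t)) by rewrite setTI.
  move=> t; rewrite !qE.
  by apply: (@additive_preimage _ kappa setT (Phi m)) => {}t; rewrite setTI.
have pos k : 0 < 2 ^- k :> R by rewrite invr_gt0 exprn_gt0.
have [||||k kP] := ville (p := fun k t => q t / 2 ^+ k.+2) (y := y) computable_ppushforward randy.
- by move=> k s; rewrite divr_ge0// exprn_ge0.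
- by move=> k s; rewrite q_add mulrDl.
- by move=> k; rewrite ler_piMl// ltW.
- apply: (creal_div_exp2 (r := fun s => q (decode (nth 0%N s 1)))
    (f := fun s => (nth 0%N s 0).+2)); last by rec_tac.
  apply: (creal_subst (creal_Phi eCP eFP ck) (l := fun s => [:: m; nth 0%N s 1])); rec_tac.
exists (Num.min (2 ^- k.+2) (Py k.+1)); first by rewrite lt_min pos Py_gt0.
move=> n; have [lt_kn|le_nk] := ltnP k n.
  apply: le_trans (ltW (kP n lt_kn)); rewrite mulrC ler_wpM2l ?fine_ge0//.
  by rewrite ge_min lexx.
apply: (@le_trans _ _ (Py k.+1)); last first.
  apply: fine_measure_le; try exact: measurable_cylinder.
  by apply: prefix_cylinder; apply: prefix_mkseq; exact: leqW.
apply: (@le_trans _ _ (Num.min (2 ^- k.+2) (Py k.+1))).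
  by rewrite ler_piMr ?q_le1 // le_min !ltW ?Py_gt0.
by rewrite ge_min lexx orbT.
Qed.

End SchnorrLayerwise.

(* A test is determined by its program, so countably many bounds suffice. *)
Lemma test_measures {R : realType} (mu : probability cantor R) :
  computable_measure mu ->
  exists kappa : nat -> probability cantor R,
    (forall i, computable_measure (kappa i)) /\
    forall t (nu : probability cantor R),
      lower_semicomputable t -> computable_measure nu ->
      (forall s, (\int[mu]_(z in cylinder s) t z <= nu (cylinder s))%E) ->
      exists i, forall s, (\int[mu]_(z in cylinder s) t z <= kappa i (cylinder s))%E.
Proof.
move=> cmu; have [u u_surj] := recf_enumeration.
pose program (i : nat) (t : cantor -> \bar R) := exists2 g : nat -> cantor -> R,
  forall k x, computes_real x (u i) [:: k] (g k x)
  & forall x, t x = (\sum_(0 <= k <oo) (g k x)%:E)%E.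
have program_inj i t t' : program i t -> program i t' -> t = t'.
  move=> [g eg tE] [g' eg' tE']; apply/funext => x; rewrite tE tE'.
  by apply: eq_eseriesr => k _; congr (_%:E); exact: computes_real_inj (eg k x) (eg' k x).
pose test (i : nat) (nu : probability cantor R) := exists t, [/\ program i t,
  computable_measure nu &
  forall s, (\int[mu]_(z in cylinder s) t z <= nu (cylinder s))%E].
have /choice[kappa kappaP] (i : nat) : exists kappa : probability cantor R,
    computable_measure kappa /\ ((exists nu, test i nu) -> test i kappa).
  have [[nu [t [ti cnu tnu]]]|ntest] := pselect (exists nu, test i nu).
    by exists nu; split=> // _; exists t.
  (* An index whose program defines no bounded test receives [mu], merely as some computable
     probability. *)
  by exists mu; split.
exists kappa; split=> [i|t nu [g [g0 [e eg]] tE] cnu tnu]; first by have [] := kappaP i.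
have [i ui] := u_surj e; exists i.
have ti : program i t by exists g => //; rewrite ui.
have [_ []] := kappaP i; first by exists nu, t.
by move=> t' [ti' _]; rewrite (program_inj _ _ _ ti ti').
Qed.

(** The difference of the two sides is additive, so its sign can be checked on strings of length
    [L], each of which lies inside or outside the decidable set. *)
Lemma le_measure_of_density {R : realType} (mu nu : {finite_measure set cantor -> \bar R})
    (B : R) (D : pred (seq bool)) L s : (size s <= L)%N ->
  (forall t, prefix s t -> B * fine (mu (cylinder t)) <= fine (nu (cylinder t))) ->
  0 <= B ->
  B * fine (mu ([set x : cantor | D (mkseq x L)] `&` cylinder s)) <=
  fine (nu ([set x : cantor | D (mkseq x L)] `&` cylinder s)).
Proof.
move=> le_sL dens B0; set A := [set x : cantor | _]; rewrite -subr_ge0.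
have mA : measurable A by exact: measurable_decide.
pose d t := fine (nu (A `&` cylinder t)) - B * fine (mu (A `&` cylinder t)).
rewrite -/(d s); apply: (@additive_ge0 _ d L) => //.
  move=> t; rewrite /d (additive_measureI mu mA) (additive_measureI nu mA); lra.
move=> t st szt; rewrite /d !measureI_decide//; case: ifP => _.
  by rewrite subr_ge0 dens.
by rewrite mulr0 subrr.
Qed.

(** * Construction of a random preimage of [y] *)

Theorem theorem4p7 (R : realType) (mu : probability cantor R)
    (T : partial_map) (y : cantor) :
  computable_measure mu ->
  schnorr_layerwise_computable mu T ->
  computably_random (ppushforward mu T) y ->
  exists x : cantor, [/\ pdom T x, y = T x & computably_random mu x].
Proof.
move=> cmu [C [F [[eC eCP] [eF eFP] muC cC CT]]] randy.
have mu1 : mu setT = 1%E by exact: probability_setT.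
have mC n : measurable (C n) by exact: (measurable_C eCP).
have [m [N mN]] := layer_bound mu1 cmu eCP eFP muC cC CT randy.
have [kappa [ckappa kappaP]] := test_measures cmu.
have kappa1 i : kappa i setT = 1%E by exact: probability_setT.
have /choice[a aP] (i : nat) : exists a : R, 0 < a /\ forall n,
    a * fine (kappa i (total_map eC eF m @^-1` cylinder (mkseq y n))) <=
    fine (ppushforward mu T (cylinder (mkseq y n))).
  have [a a0 aP] := Py_ge mu1 cmu eCP eFP muC cC CT randy m (kappa1 i) (ckappa i).
  by exists a.
pose V n : set cantor := total_map eC eF m @^-1` cylinder (mkseq y n).
have mV n : measurable (V n) by exact: (measurable_Phi eCP eFP).
pose w n s := fine (mu ((C m `&` V n) `&` cylinder s)).
(* The weight of [kappa i] is [b i / 2]. By the choice of [a i], its term at the empty string is at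
   most [2 ^- i.+1] times half of the measure of the cylinder of [y], so the weighted sum stays
   below that half. *)
pose b i := a i / 2 ^+ i.+1.
have b_gt0 i : 0 < b i by rewrite divr_gt0 ?exprn_gt0//; case: (aP i).
pose v n s := \sum_(0 <= i < n) b i / 2 * fine (kappa i (V n `&` cylinder s)).
have v_ge0 n s : 0 <= v n s.
  by apply: sumr_ge0 => i _; rewrite mulr_ge0 ?fine_ge0// divr_ge0// ltW.
pose d n s := w n s - v n s.
have d_add n : cyl_additive (d n).
  move=> s; have mCV : measurable (C m `&` V n) by exact: measurableI.
  rewrite /d /w /v (additive_measureI mu mCV).
  rewrite (eq_bigr (fun i => b i / 2 * fine (kappa i (V n `&` cylinder (rcons s false))) +
     b i / 2 * fine (kappa i (V n `&` cylinder (rcons s true))))).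
    by rewrite big_split/=; lra.
  by move=> i _; rewrite -mulrDr (additive_measureI (kappa i) (mV n)).
have d_nil n : (N < n)%N -> 0 < d n [::].
  move=> lt_Nn; have := mN n lt_Nn; set P := fine (ppushforward _ _ _) => ltP.
  have PE : P = w n [::] + fine (mu (ppreimage T (cylinder (mkseq y n)) `\` C m)).
    rewrite /w cylinder_nil setIT setIC /V.
    rewrite -(ppreimage_Phi eCP eFP CT) -fine_measure_split//.
    exact: measurable_ppreimage_cylinder.
  have v_le : v n [::] <= P / 2.
    apply: (@le_trans _ _ (\sum_(0 <= i < n) 2 ^- i.+1 * (P / 2))).
      apply: ler_sum => i _; have [_ /(_ n)] := aP i.
      rewrite cylinder_nil setIT -/P -/(V n) => leP.
      rewrite /b; set k := fine _ in leP *.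
      have : 0 <= 2 ^- i.+1 :> R by rewrite invr_ge0 exprn_ge0.
      move: (2 ^- i.+1) => z z0; have := ler_wpM2l z0 leP; lra.
    rewrite -mulr_suml sum_exprV2.
    have P0 : 0 <= P by exact: fine_ge0.
    have : 0 <= 2 ^- n :> R by rewrite invr_ge0 exprn_ge0.
    move: (2 ^- n) => z z0; have := mulr_ge0 z0 P0; lra.
  rewrite /d; lra.
(* The difference [d n] changes with [n], so the invariant asks for positivity at arbitrarily large
   [n]. By additivity each such [n] passes to a child, and one of the two children receives
   unboundedly many. *)
have [||x xP] := @tree_path (fun s => forall M, exists2 n, (M < n)%N & 0 < d n s).
- move=> M; exists (maxn M N).+1; first by rewrite ltnS leq_maxl.
  by apply: d_nil; rewrite ltnS leq_maxr.
- move=> s ds; apply: contrapT => nb.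
  have stop c : exists M, forall n, (M < n)%N -> d n (rcons s c) <= 0.
    apply: contrapT => nM; apply: nb; exists c => M; apply: contrapT => nn.
    apply: nM; exists M => n lt_n; rewrite leNgt; apply/negP => d0.
    by apply: nn; exists n.
  have [M0 M0P] := stop false; have [M1 M1P] := stop true.
  have [n] := ds (maxn M0 M1); rewrite gtn_max => /andP[lt0 lt1].
  by rewrite d_add; have := M0P n lt0; have := M1P n lt1; lra.
have w_gt0 k n : 0 < d n (mkseq x k) -> 0 < w n (mkseq x k).
  by have := v_ge0 n (mkseq x k); rewrite /d; lra.
have meets k n : 0 < d n (mkseq x k) ->
    exists z, [/\ C m z, V n z & cylinder (mkseq x k) z].
  move=> /w_gt0 w0; apply: contrapT => nz; move: w0; rewrite /w.
  rewrite (_ : _ `&` _ = set0) ?measure0 ?ltxx//.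
  by apply/seteqP; split=> // z [[Cz Vz] xz]; case: nz; exists z.
(* Otherwise some prefix of [x] is seen to leave [C m], whereas its cylinder meets [C m]. *)
have Cx : C m x.
  apply: contrapT => /(leavesP eCP)[k lv]; have [n _ /meets[z [Cz _]]] := xP k 0%N.
  rewrite cylinder_mkseqE => zx; apply: (leaves_notin eCP (n := k)) Cz.
  by rewrite zx.
have [dx Fx] := CT _ _ Cx; exists x; split=> //.
  rewrite -Fx -(Phi_F eCP eFP Cx); apply/funext => k.
  (* Near [x] the first [k.+1] bits of the image are constant, and some nearby [z] has an image that
     agrees with [y] beyond position [k]. *)
  have [l lP] := Phi_continuous eCP eFP m x k.+1.
  have [n lt_kn /meets[z [_ Vz /lP]]] := xP l k.
  move: Vz; rewrite /V /= cylinder_mkseqE => Vz /(congr1 (nth false ^~ k)).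
  rewrite !nth_mkseq// => <-; have := congr1 (nth false ^~ k) Vz.
  by rewrite !nth_mkseq.
move=> t nu lt cnu tnu; have [i tkappa] := kappaP t nu lt cnu tnu.
rewrite ltNge; apply/negP => t_oo; have b2 : 0 < 2 / b i by rewrite divr_gt0.
(* The level [2 / b i] is the inverse of the weight of [kappa i]. *)
have [|k kP] := lower_semicomputable_open (x := x) (B := 2 / b i) lt.
  by rewrite (lt_le_trans _ t_oo)// ltry.
have [L [_ LP]] := ready_bound eCP eFP.
(* Taking [n] above [i] ensures that [kappa i] has its term in [v n]. *)
have [n lt_in d0] := xP k i.
(* A prefix of length [A] decides membership in [V n], and it is no shorter than [mkseq x k], below
   which the densities are compared. *)
pose A := maxn (L [:: m; n]) k.
have VE : V n = [set z : cantor | agree eC eF m (mkseq y n) (mkseq z A)].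
  have rdy (z : cantor) : ready eC eF m (size (mkseq y n)) (mkseq z A).
    by rewrite size_mkseq; apply: (LP [:: m; n]); rewrite size_mkseq leq_maxl.
  by apply/seteqP; split=> z /(Phi_cylinder (rdy z)).
have dens s : prefix (mkseq x k) s ->
    2 / b i * fine (mu (cylinder s)) <= fine (kappa i (cylinder s)).
  move=> xs; have ms := measurable_cylinder s.
  have sB z : cylinder s z -> ((2 / b i)%:E <= t z)%E.
    by move=> sz; apply/ltW/kP; exact: prefix_cylinder sz.
  have int_ge := lower_semicomputable_integral mu lt (ltW b2) sB.
  rewrite -lee_fin EFinM !fineK ?fin_num_measure//.
  exact: (le_trans int_ge (tkappa s)).
have := @le_measure_of_density _ mu (kappa i) _ (agree eC eF m (mkseq y n)) A
  (mkseq x k) _ dens (ltW b2).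
rewrite size_mkseq leq_maxr => /(_ isT); rewrite -VE => le_kappa.
have w_le : w n (mkseq x k) <= fine (mu (V n `&` cylinder (mkseq x k))).
  apply: fine_measure_le.
  - by apply: measurableI (measurable_cylinder _); exact: measurableI.
  - by apply: measurableI (measurable_cylinder _).
  - by move=> z [[_ Vz] xz].
have v_ge : b i / 2 * fine (kappa i (V n `&` cylinder (mkseq x k))) <= v n (mkseq x k).
  rewrite /v (big_cat_nat (leq0n _) lt_in)/= big_nat_recr//=.
  rewrite -addrA [leRHS]addrC -addrA lerDl addr_ge0//; apply: sumr_ge0 => j _;
    by rewrite mulr_ge0 ?fine_ge0// divr_ge0// ltW.
move: d0; rewrite /d subr_gt0 ltNge => /negP; apply.
apply: le_trans w_le (le_trans _ v_ge).
rewrite -(ler_pM2l b2) mulrA.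
have -> : 2 / b i * (b i / 2) = 1 by field; rewrite gt_eqF.
by rewrite mul1r.
Qed.
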